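(* Let $\Delta t>0$, and let a sequence $(f^n,\mathbf{E}^n,\mathbf{B}^n)_{n\ge 0}$ (together with the intermediate half-step quantities) be generated by one of the four time-stepping methods Scheme-1$(\Delta t)$, Scheme-2$(\Delta t)$, Scheme-3$(\Delta t)$, Scheme-4$(\Delta t)$ described in the context. Then $TE_n=TE_{n+1}$ for all $n\ge 0$, where: (i) for Scheme-2$(\Delta t)$ and Scheme-4$(\Delta t)$, $$2\,TE_n=\int_{\Omega_x}\int_{\Omega_v} f^n|\mathbf{v}|^2\,d\mathbf{v}\,d\mathbf{x}+\int_{\Omega_x}\big(|\mathbf{E}^n|^2+|\mathbf{B}^n|^2\big)\,d\mathbf{x};$$ (ii) for Scheme-1$(\Delta t)$, $$2\,TE_n=\int_{\Omega_x}\int_{\Omega_v} f^n|\mathbf{v}|^2\,d\mathbf{v}\,d\mathbf{x}+\int_{\Omega_x}\big(|\mathbf{E}^n|^2+\mathbf{B}^{n-1/2}\cdot\mathbf{B}^{n+1/2}\big)\,d\mathbf{x}$$ $$=\int_{\Omega_x}\int_{\Omega_v} f^n|\mathbf{v}|^2\,d\mathbf{v}\,d\mathbf{x}+\int_{\Omega_x}\big(|\mathbf{E}^n|^2+|\mathbf{B}^n|^2\big)\,d\mathbf{x}-\frac{\Delta t^2}{4}\int_{\Omega_x}|\nabla_{\mathbf{x}}\times\mathbf{E}^n|^2\,d\mathbf{x};$$ (iii) for Scheme-3$(\Delta t)$, $$2\,TE_n=\int_{\Omega_x}\int_{\Omega_v} f^n|\mathbf{v}|^2\,d\mathbf{v}\,d\mathbf{x}+\int_{\Omega_x}\big(|\mathbf{B}^n|^2+\mathbf{E}^{n-1/2}\cdot\mathbf{E}^{n+1/2}\big)\,d\mathbf{x}$$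 $$=\int_{\Omega_x}\int_{\Omega_v} f^n|\mathbf{v}|^2\,d\mathbf{v}\,d\mathbf{x}+\int_{\Omega_x}\big(|\mathbf{E}^n|^2+|\mathbf{B}^n|^2\big)\,d\mathbf{x}-\frac{\Delta t^2}{4}\int_{\Omega_x}|\nabla_{\mathbf{x}}\times\mathbf{B}^n-\mathbf{J}^n|^2\,d\mathbf{x}.$$
   Context: Setting. $\Omega_x\subset\mathbb{R}^3$ is a box with periodic boundary conditions and $\Omega_v\subset\mathbb{R}^3$ is a bounded velocity domain. The unknowns are $f=f(\mathbf{x},\mathbf{v})$ on $\Omega_x\times\Omega_v$ (scalar) and $\mathbf{E}(\mathbf{x}),\mathbf{B}(\mathbf{x})\in\mathbb{R}^3$ on $\Omega_x$. All functions are smooth enough for the expressions below to make sense, periodic in $\mathbf{x}$, and all $f$'s (including intermediate ones) vanish on $\partial\Omega_v$. For any time index $s$, $\mathbf{J}^s(\mathbf{x})=\int_{\Omega_v}f^s(\mathbf{x},\mathbf{v})\,\mathbf{v}\,d\mathbf{v}$. The schemes discretize in time the Vlasov–Maxwell system $\partial_t f+\mathbf{v}\cdot\nabla_{\mathbf{x}}f+(\mathbf{E}+\mathbf{v}\times\mathbf{B})\cdot\nabla_{\mathbf{v}}f=0$, $\partial_t\mathbf{E}=\nabla_{\mathbf{x}}\times\mathbf{B}-\mathbf{J}$, $\partial_t\mathbf{B}=-\nabla_{\mathbf{x}}\times\mathbf{E}$ (with $\mathbf{x},\mathbf{v}$ continuous). Each scheme maps $(f^n,\mathbf{E}^n,\mathbf{B}^n)$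 to $(f^{n+1},\mathbf{E}^{n+1},\mathbf{B}^{n+1})$; for implicit schemes, this means any solution of the stated equations. Scheme-1$(\Delta t)$: $\frac{f^{n+1/2}-f^n}{\Delta t/2}+\mathbf{v}\cdot\nabla_{\mathbf{x}}f^n+(\mathbf{E}^n+\mathbf{v}\times\mathbf{B}^n)\cdot\nabla_{\mathbf{v}}f^n=0$; $\frac{\mathbf{B}^{n+1/2}-\mathbf{B}^n}{\Delta t/2}=-\nabla_{\mathbf{x}}\times\mathbf{E}^n$; $\frac{\mathbf{E}^{n+1}-\mathbf{E}^n}{\Delta t}=\nabla_{\mathbf{x}}\times\mathbf{B}^{n+1/2}-\mathbf{J}^{n+1/2}$; $\frac{\mathbf{B}^{n+1}-\mathbf{B}^{n+1/2}}{\Delta t/2}=-\nabla_{\mathbf{x}}\times\mathbf{E}^{n+1}$; $\frac{f^{n+1}-f^n}{\Delta t}+\mathbf{v}\cdot\nabla_{\mathbf{x}}f^{n+1/2}+\big(\tfrac12(\mathbf{E}^n+\mathbf{E}^{n+1})+\mathbf{v}\times\mathbf{B}^{n+1/2}\big)\cdot\nabla_{\mathbf{v}}f^{n+1/2}=0$. Scheme-2$(\Delta t)$: $\frac{f^{n+1/2}-f^n}{\Delta t/2}+\mathbf{v}\cdot\nabla_{\mathbf{x}}f^n+(\mathbf{E}^n+\mathbf{v}\times\mathbf{B}^n)\cdot\nabla_{\mathbf{v}}f^n=0$; $\frac{\mathbf{B}^{n+1}-\mathbf{B}^n}{\Delta t}=-\nabla_{\mathbf{x}}\times\frac{\mathbf{E}^n+\mathbf{E}^{n+1}}{2}$;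 $\frac{\mathbf{E}^{n+1}-\mathbf{E}^n}{\Delta t}=\nabla_{\mathbf{x}}\times\frac{\mathbf{B}^n+\mathbf{B}^{n+1}}{2}-\mathbf{J}^{n+1/2}$; $\frac{f^{n+1}-f^n}{\Delta t}+\mathbf{v}\cdot\nabla_{\mathbf{x}}f^{n+1/2}+\big(\tfrac12(\mathbf{E}^n+\mathbf{E}^{n+1})+\tfrac12\mathbf{v}\times(\mathbf{B}^n+\mathbf{B}^{n+1})\big)\cdot\nabla_{\mathbf{v}}f^{n+1/2}=0$. Scheme-3$(\Delta t)$: $\frac{\mathbf{E}^{n+1/2}-\mathbf{E}^n}{\Delta t/2}=\nabla_{\mathbf{x}}\times\mathbf{B}^n-\mathbf{J}^n$; $\frac{\mathbf{B}^{n+1}-\mathbf{B}^n}{\Delta t}=-\nabla_{\mathbf{x}}\times\mathbf{E}^{n+1/2}$; $\frac{f^{n+1}-f^n}{\Delta t}+\mathbf{v}\cdot\nabla_{\mathbf{x}}\frac{f^n+f^{n+1}}{2}+\big(\mathbf{E}^{n+1/2}+\mathbf{v}\times\frac{\mathbf{B}^n+\mathbf{B}^{n+1}}{2}\big)\cdot\nabla_{\mathbf{v}}\frac{f^n+f^{n+1}}{2}=0$; $\frac{\mathbf{E}^{n+1}-\mathbf{E}^{n+1/2}}{\Delta t/2}=\nabla_{\mathbf{x}}\times\mathbf{B}^{n+1}-\mathbf{J}^{n+1}$. Scheme-4$(\Delta t)$: $\frac{\mathbf{B}^{n+1}-\mathbf{B}^n}{\Delta t}=-\nabla_{\mathbf{x}}\times\frac{\mathbf{E}^n+\mathbf{E}^{n+1}}{2}$;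 $\frac{\mathbf{E}^{n+1}-\mathbf{E}^n}{\Delta t}=\nabla_{\mathbf{x}}\times\frac{\mathbf{B}^n+\mathbf{B}^{n+1}}{2}-\frac{\mathbf{J}^n+\mathbf{J}^{n+1}}{2}$; $\frac{f^{n+1}-f^n}{\Delta t}+\mathbf{v}\cdot\nabla_{\mathbf{x}}\frac{f^n+f^{n+1}}{2}+\big(\tfrac12(\mathbf{E}^n+\mathbf{E}^{n+1})+\tfrac12\mathbf{v}\times(\mathbf{B}^n+\mathbf{B}^{n+1})\big)\cdot\nabla_{\mathbf{v}}\frac{f^n+f^{n+1}}{2}=0$. Half-step values: $\mathbf{B}^{n+1/2}$ in Scheme-1 and $\mathbf{E}^{n+1/2}$ in Scheme-3 are the intermediate values computed in the step from $n$ to $n+1$; $\mathbf{B}^{n-1/2}$, $\mathbf{E}^{n-1/2}$ for $n\ge1$ are those computed in the previous step, and for $n=0$ one sets $\mathbf{B}^{-1/2}:=2\mathbf{B}^0-\mathbf{B}^{1/2}$ and $\mathbf{E}^{-1/2}:=2\mathbf{E}^0-\mathbf{E}^{1/2}$. *)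

(* Defs.v *)
From HB Require Import structures.
From mathcomp Require Import all_boot all_order all_algebra.
From mathcomp Require Import all_classical all_reals all_analysis.

Set Implicit Arguments.
Unset Strict Implicit.
Unset Printing Implicit Defensive.

Import Order.TTheory GRing.Theory Num.Theory.
Import numFieldNormedType.Exports.

Local Open Scope classical_set_scope.
Local Open Scope ring_scope.

Section VectorCalculus.
Variable R : realType.
Local Notation V3 := 'rV[R]_3.

(* The library norm on 'rV[R]_3 is the sup norm, so |u|^2 is dot u u. *)
Definition dot (u w : V3) : R := \sum_(i < 3) u 0 i * w 0 i.

(* Index addition in 'I_3 is modulo 3, which gives the cyclic formulas for the
   cross product and the curl. *)
Definition cross (u w : V3) : V3 :=
  \row_(i < 3) (u 0 (i + 1) * w 0 (i + 2) - u 0 (i + 2) * w 0 (i + 1)).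

Definition partial (i : 'I_3) (g : V3 -> R) (x : V3) : R :=
  'D_(delta_mx 0 i : V3) g x.

Definition grad (g : V3 -> R) (x : V3) : V3 := \row_(i < 3) partial i g x.

Definition curl (F : V3 -> V3) (x : V3) : V3 :=
  \row_(i < 3) (partial (i + 1) (fun y => F y 0 (i + 2)) x
                - partial (i + 2) (fun y => F y 0 (i + 1)) x).

(* The library has no measure on 'rV[R]_3: integrals over R^3 are taken with
   respect to the threefold product of the Lebesgue measure on R, transported
   along the coordinate map [vec3]. *)
Definition vec3 (p : measurableTypeR R * measurableTypeR R * measurableTypeR R)
  : V3 := \row_(i < 3) [:: p.1.1; p.1.2; p.2]`_i.

Definition int3 (A : set V3) (g : V3 -> R) : R :=
  Rintegral (@lebesgue_measure R \x @lebesgue_measure R \x @lebesgue_measure R)%E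
    (vec3 @^-1` A) (g \o vec3).

Definition box (a b : V3) : set V3 :=
  [set x | forall i : 'I_3, a 0 i <= x 0 i <= b 0 i].

End VectorCalculus.

Definition domain (T : topologicalType) (O : set T) : Prop :=
  [/\ open O, connected O & O !=set0].

(* C^1 up to the boundary: [g] is continuous on the closure of the open set
   [O], and each of its directional derivatives exists on [O] and extends
   continuously to the closure. *)
Definition C1_closure (R : realType) (V W : normedModType R)
    (O : set V) (g : V -> W) : Prop :=
  {within closure O, continuous g} /\
  forall d : V, exists2 dg : V -> W, {within closure O, continuous dg} &
    forall p, O p -> is_derive p d g (dg p).

Section VlasovMaxwell.
Variable R : realType.
Local Notation V3 := 'rV[R]_3.
Implicit Types (a b : V3) (Ov : set V3) (dt : R).

Definition box_periodic a b (W : zmodType) (F : V3 -> W) : Prop :=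
  forall i : 'I_3, periodic F ((b 0 i - a 0 i) *: (delta_mx 0 i : V3)).

(* Functions on the periodic box are represented by periodic functions on R^3. *)
Definition admissible_field a b (F : V3 -> V3) : Prop :=
  C1_closure setT F /\ box_periodic a b F.

(* Only the values of [f x v] for [v] in the closure of [Ov] are relevant. *)
Definition admissible_density a b Ov (f : V3 -> V3 -> R) : Prop :=
  [/\ @C1_closure R (V3 * V3)%type R (setT `*` Ov) (fun p => f p.1 p.2),
      forall v, closure Ov v -> box_periodic a b (f ^~ v) &
      forall x v, (closure Ov `\` interior Ov) v -> f x v = 0].

Definition current Ov (f : V3 -> V3 -> R) (x : V3) : V3 :=
  \row_(i < 3) int3 Ov (fun v => f x v * v 0 i).

Definition transport (f : V3 -> V3 -> R) (E B : V3 -> V3) (x v : V3) : R :=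
  dot v (grad (f ^~ v) x) + dot (E x + cross v (B x)) (grad (f x) v).

Definition mean_field (F G : V3 -> V3) (x : V3) : V3 := 2^-1 *: (F x + G x).

Definition mean_density (f g : V3 -> V3 -> R) (x v : V3) : R :=
  2^-1 * (f x v + g x v).

(* In the schemes, [fh n], [Eh n], [Bh n] are the intermediate values with
   superscript n + 1/2. *)
Definition scheme1 Ov dt (f fh : nat -> V3 -> V3 -> R)
    (E B Bh : nat -> V3 -> V3) : Prop :=
  forall n,
  [/\ forall x v, Ov v ->
        (fh n x v - f n x v) / (dt / 2) + transport (f n) (E n) (B n) x v = 0,
      forall x, (dt / 2)^-1 *: (Bh n x - B n x) = - curl (E n) x,
      forall x, dt^-1 *: (E n.+1 x - E n x)
        = curl (Bh n) x - current Ov (fh n) x,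
      forall x, (dt / 2)^-1 *: (B n.+1 x - Bh n x) = - curl (E n.+1) x &
      forall x v, Ov v ->
        (f n.+1 x v - f n x v) / dt
        + transport (fh n) (mean_field (E n) (E n.+1)) (Bh n) x v = 0].

Definition scheme2 Ov dt (f fh : nat -> V3 -> V3 -> R)
    (E B : nat -> V3 -> V3) : Prop :=
  forall n,
  [/\ forall x v, Ov v ->
        (fh n x v - f n x v) / (dt / 2) + transport (f n) (E n) (B n) x v = 0,
      forall x, dt^-1 *: (B n.+1 x - B n x)
        = - curl (mean_field (E n) (E n.+1)) x,
      forall x, dt^-1 *: (E n.+1 x - E n x)
        = curl (mean_field (B n) (B n.+1)) x - current Ov (fh n) x &
      forall x v, Ov v ->
        (f n.+1 x v - f n x v) / dt
        + transport (fh n) (mean_field (E n) (E n.+1))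
            (mean_field (B n) (B n.+1)) x v = 0].

Definition scheme3 Ov dt (f : nat -> V3 -> V3 -> R)
    (E Eh B : nat -> V3 -> V3) : Prop :=
  forall n,
  [/\ forall x, (dt / 2)^-1 *: (Eh n x - E n x)
        = curl (B n) x - current Ov (f n) x,
      forall x, dt^-1 *: (B n.+1 x - B n x) = - curl (Eh n) x,
      forall x v, Ov v ->
        (f n.+1 x v - f n x v) / dt
        + transport (mean_density (f n) (f n.+1)) (Eh n)
            (mean_field (B n) (B n.+1)) x v = 0 &
      forall x, (dt / 2)^-1 *: (E n.+1 x - Eh n x)
        = curl (B n.+1) x - current Ov (f n.+1) x].

Definition scheme4 Ov dt (f : nat -> V3 -> V3 -> R)
    (E B : nat -> V3 -> V3) : Prop :=
  forall n,
  [/\ forall x, dt^-1 *: (B n.+1 x - B n x)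
        = - curl (mean_field (E n) (E n.+1)) x,
      forall x, dt^-1 *: (E n.+1 x - E n x)
        = curl (mean_field (B n) (B n.+1)) x
          - mean_field (current Ov (f n)) (current Ov (f n.+1)) x &
      forall x v, Ov v ->
        (f n.+1 x v - f n x v) / dt
        + transport (mean_density (f n) (f n.+1)) (mean_field (E n) (E n.+1))
            (mean_field (B n) (B n.+1)) x v = 0].

(* Value with superscript n - 1/2, given the values [F n] at time n and [Fh n]
   at time n + 1/2. *)
Definition prev_half (F Fh : nat -> V3 -> V3) (n : nat) (x : V3) : V3 :=
  if n is m.+1 then Fh m x else 2 *: F 0%N x - Fh 0%N x.

(* The integral of f |v|^2, twice the kinetic energy. *)
Definition kinetic2 a b Ov (f : V3 -> V3 -> R) : R :=
  int3 (box a b) (fun x => int3 Ov (fun v => f x v * dot v v)).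

Definition TE a b Ov (f : nat -> V3 -> V3 -> R) (E B : nat -> V3 -> V3)
    (n : nat) : R :=
  2^-1 * (kinetic2 a b Ov (f n)
    + int3 (box a b) (fun x => dot (E n x) (E n x) + dot (B n x) (B n x))).

Definition TE_scheme1 a b Ov (f : nat -> V3 -> V3 -> R)
    (E B Bh : nat -> V3 -> V3) (n : nat) : R :=
  2^-1 * (kinetic2 a b Ov (f n)
    + int3 (box a b)
        (fun x => dot (E n x) (E n x) + dot (prev_half B Bh n x) (Bh n x))).

Definition TE_scheme3 a b Ov (f : nat -> V3 -> V3 -> R)
    (E Eh B : nat -> V3 -> V3) (n : nat) : R :=
  2^-1 * (kinetic2 a b Ov (f n)
    + int3 (box a b)
        (fun x => dot (B n x) (B n x) + dot (prev_half E Eh n x) (Eh n x))).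

End VlasovMaxwell.

(* Main.v *)
(* Multiplying the Vlasov step by |v|^2 and integrating over phase space, the
   x-transport disappears by periodicity and an integration by parts in v, which
   has no boundary term since f vanishes on the boundary of Ov, leaves the work
   -2 E . J: the magnetic force v x B has zero divergence in v and is orthogonal
   to v. In each scheme the increment of the field energy is 2 dt times
   (curl B - J) . E - curl E . B for exactly the E and B that drive the Vlasov
   step; curl being symmetric on periodic fields, only -2 dt J . E remains, which
   cancels the kinetic increment. For a leapfrogged field F with half steps
   (dt / 2) K the products F^{n-1/2} . F^{n+1/2} = |F^n|^2 - (dt^2 / 4) |K^n|^2
   have such increments.

   No regularity of the boundary of Ov is assumed. The integral of a derivative
   is reduced by Fubini to lines parallel to the axes; a line meets Ov in a
   countable union of disjoint open intervals whose endpoints lie on the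
   boundary, so the fundamental theorem of calculus gives 0 on each of them. *)
Require Import Defs.
From HB Require Import structures.
From mathcomp Require Import all_boot all_order all_algebra.
From mathcomp Require Import all_classical all_reals all_analysis measurable_realfun.
From mathcomp Require Import ring lra.
Set Implicit Arguments.
Unset Strict Implicit.
Unset Printing Implicit Defensive.
Import Order.TTheory GRing.Theory Num.Theory.
Import numFieldNormedType.Exports.
Local Open Scope classical_set_scope.
Local Open Scope ring_scope.

(** * Bounded measurable functions *)

(** Over a set of finite measure this implies integrability, and unlike integrability it is stable
    under products, so every integrability condition below reduces to closure properties of
    [bmf]. *)
Definition bmf {d} {T : measurableType d} {R : realType} (D : set T)
    (f : T -> R) : Prop :=
  measurable_fun D f /\ exists C, forall t, D t -> `|f t| <= C.

Section BoundedMeasurable.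
Context {d} {T : measurableType d} {R : realType}.
Implicit Types (D : set T) (f g : T -> R).

Lemma bmf_cst D (c : R) : bmf D (fun=> c).
Proof. by split; [exact: measurable_cst|exists `|c|]. Qed.

Lemma bmfD D f g : bmf D f -> bmf D g -> bmf D (fun t => f t + g t).
Proof.
move=> [mf [C fC]] [mg [C' gC]]; split.
  exact: (@measurable_funD _ _ _ D f g mf mg).
exists (C + C') => t Dt.
by rewrite (le_trans (ler_normD _ _))// lerD ?fC ?gC.
Qed.

Lemma bmfM D f g : bmf D f -> bmf D g -> bmf D (fun t => f t * g t).
Proof.
move=> [mf [C fC]] [mg [C' gC]]; split.
  exact: (@measurable_funM _ _ _ D f g mf mg).
exists (C * C') => t Dt.
by rewrite normrM ler_pM// ?fC ?gC.
Qed.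

Lemma bmfZ D (c : R) f : bmf D f -> bmf D (fun t => c * f t).
Proof. by move=> bf; apply: bmfM => //; exact: bmf_cst. Qed.

Lemma bmfB D f g : bmf D f -> bmf D g -> bmf D (fun t => f t - g t).
Proof.
move=> bf bg; apply: bmfD => //.
have := bmfZ (-1) bg; under eq_fun do rewrite mulN1r; exact.
Qed.

Lemma bmf_sum D n (f : 'I_n -> T -> R) :
  (forall i, bmf D (f i)) -> bmf D (fun t => \sum_i f i t).
Proof.
elim: n f => [|n IH] f bf.
  by under eq_fun do rewrite big_ord0; exact: bmf_cst.
by under eq_fun do rewrite big_ord_recr; apply: bmfD => //; exact: IH.
Qed.

Lemma eq_bmf D f g : {in D, f =1 g} -> bmf D f -> bmf D g.
Proof.
move=> fg [mf [C fC]]; split.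
  exact: eq_measurable_fun mf.
by exists C => t Dt; rewrite -fg ?inE//; exact: fC.
Qed.

Lemma bmf_restrict D f : measurable D -> bmf D f -> bmf setT (f \_ D).
Proof.
move=> mD [mf [C fC]]; split.
  by apply/measurable_restrict => //; rewrite setTI.
exists `|C| => t _; rewrite patchE; case: ifPn => tD.
  by rewrite (le_trans (fC _ _)) ?ler_norm// -in_setE.
by rewrite normr0.
Qed.

Lemma bmf_integrable (mu : {measure set T -> \bar R}) D f :
  measurable D -> (mu D < +oo)%E -> bmf D f -> mu.-integrable D (EFin \o f).
Proof.
move=> mD Doo [mf [C fC]]; apply: measurable_bounded_integrable => //.
exists C; split; first exact: num_real.
by move=> M CM t Dt /=; rewrite (le_trans (fC _ Dt))// ltW.
Qed.

End BoundedMeasurable.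

Lemma Rintegral0_eq {d} {T : measurableType d} {R : realType}
    (mu : {measure set T -> \bar R}) (D : set T) (f : T -> R) :
  (forall t, D t -> f t = 0) -> \int[mu]_(t in D) f t = 0.
Proof. by move=> f0; rewrite /Rintegral integral0_eq// => t Dt; rewrite f0. Qed.

(** * Borel preimages and continuous integrands *)

Section BorelPreimage.
Context {d} {T : measurableType d} {R : realType}.

(** The points [q i] are dense and countably many, so an open set is the countable union of the
    balls with centre [q i] and radius [1 / (n + 1)] that it contains. Measurability on such balls
    is therefore enough. *)
Lemma borel_preimage (X : pseudoMetricType R) (I : countType) (q : I -> X)
    (phi : T -> X) :
  (forall x (e : R), 0 < e -> exists i, ball x e (q i)) ->
  (forall i (r : R), 0 < r -> measurable (phi @^-1` ball (q i) r)) ->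
  forall U, open U -> measurable (phi @^-1` U).
Proof.
move=> dq mb U oU.
pose J (ij : I * nat) := ball (q ij.1) (ij.2.+1%:R^-1 : R).
have -> : phi @^-1` U =
    \bigcup_ij (if `[< J ij `<=` U >] then phi @^-1` J ij else set0).
  apply/seteqP; split => [t Ut|t [ij _]]; last first.
    by case: asboolP => // JU /JU.
  have /nbhs_ballP [e /= e0 eU] : nbhs (phi t) U by exact: open_nbhs_nbhs.
  (* A radius below [e / 2] keeps the ball around the chosen centre inside the [e]-ball around
     [phi t], by the triangle inequality. *)
  have [n ne] : exists n, n.+1%:R^-1 < e / 2.
    have e20 : 0 < e / 2 by rewrite divr_gt0.
    have [n _ nP] := near_infty_natSinv_lt (PosNum e20).
    by exists n; exact: (nP n (leqnn n)).
  have n0 : 0 < (n.+1%:R^-1 : R) by rewrite invr_gt0.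
  have [i qi] := dq (phi t) _ n0.
  exists (i, n) => //; case: asboolP => [_|[]]; first exact: ball_sym.
  move=> y Jy; apply: eU.
  apply: (@le_ball _ _ _ (n.+1%:R^-1 + n.+1%:R^-1)).
    by rewrite [leRHS]splitr lerD// ltW.
  exact: ball_triangle qi Jy.
apply: countable_bigcupT_measurable => // ij.
by case: asboolP => _; [exact: mb|exact: measurable0].
Qed.

(** As [g] is continuous only on [A], the preimage of an open interval is the trace on [A] of some
    open [V]. Since [phi] sends [D] into [A], pulling back within [D] sees only [V]. *)
Lemma measurable_within_comp (X : topologicalType) (phi : T -> X) (D : set T)
    (A : set X) (g : X -> R) :
  (forall U, open U -> measurable (phi @^-1` U)) -> measurable D ->
  D `<=` phi @^-1` A -> {within A, continuous g} ->
  measurable_fun D (g \o phi).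
Proof.
move=> bphi mD DA /continuousP cg.
apply: (measurability _ (RGenOpens.measurableE R)).
move=> _ [_ [u [v ->] <-]].
have /cg/open_subspaceP [V oV VA] : open `]u, v[%classic.
  exact: interval_open.
rewrite (_ : _ `&` _ = D `&` phi @^-1` V); first exact/measurableI/bphi.
apply/seteqP; split => t [Dt /= h]; split => //.
- have : (V `&` A) (phi t) by rewrite VA; split => //; exact: DA.
  by case.
- have : (g @^-1` `]u, v[%classic `&` A) (phi t).
    by rewrite -VA; split => //; exact: DA.
  by case.
Qed.

Lemma bmf_within_comp (X : topologicalType) (phi : T -> X) (D : set T)
    (A : set X) (g : X -> R) :
  (forall U, open U -> measurable (phi @^-1` U)) -> measurable D ->
  D `<=` phi @^-1` A -> compact A -> {within A, continuous g} ->
  bmf D (g \o phi).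
Proof.
move=> bphi mD DA cA cg; split; first exact: measurable_within_comp cg.
have /compact_bounded [M [_ MP]] := continuous_compact cg cA.
exists (M + 1) => t Dt; apply: (MP (M + 1)); first by rewrite ltrDl.
by exists (phi t) => //; exact: DA.
Qed.

End BorelPreimage.

(** * Sigma-finiteness of product measures *)

(* Canonical inference finds a sigma-finite structure on [m1 \x m2] only when m1
   and m2 are subprobabilities. This alias carries one in general and is
   convertible to [m1 \x m2] as a measure. *)
Definition sf_product {d1 d2} {T1 : measurableType d1} {T2 : measurableType d2}
    {R : realType} (m1 : {sigma_finite_measure set T1 -> \bar R})
    (m2 : {sigma_finite_measure set T2 -> \bar R}) : set (T1 * T2) -> \bar R :=
  (m1 \x m2)%E.

Section SigmaFiniteProduct.
Context {d1 d2} {T1 : measurableType d1} {T2 : measurableType d2} {R : realType}.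
Variables (m1 : {sigma_finite_measure set T1 -> \bar R}).
Variables (m2 : {sigma_finite_measure set T2 -> \bar R}).

HB.instance Definition _ := Measure.on (sf_product m1 m2).

Lemma sf_product_sigma_finite : sigma_finite setT (sf_product m1 m2).
Proof.
have /sigma_finiteP[F [TF ndF Foo]] := sigma_finiteT m1.
have /sigma_finiteP[G [TG ndG Goo]] := sigma_finiteT m2.
(* Both exhaustions are nondecreasing, so the diagonal rectangles suffice: a point of [F n] and a
   point of [G k] both survive to index [n + k]. *)
exists (fun n => F n `*` G n).
  apply/seteqP; split => // -[x y] _.
  have [n _ Fx] : (\bigcup_n F n) x by rewrite -TF.
  have [k _ Gy] : (\bigcup_n G n) y by rewrite -TG.
  exists (n + k)%N => //; split => /=.
    by move: x Fx; exact/subsetPset/ndF/leq_addr.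
  by move: y Gy; exact/subsetPset/ndG/leq_addl.
move=> n; have [mF Fnoo] := Foo n; have [mG Gnoo] := Goo n.
split; first exact: measurableX.
by rewrite /sf_product product_measure1E// lte_mul_pinfty// ge0_fin_numE.
Qed.

HB.instance Definition _ := Measure_isSigmaFinite.Build _ _ _
  (sf_product m1 m2) sf_product_sigma_finite.

Lemma sf_productE (A1 : set T1) (A2 : set T2) :
  measurable A1 -> measurable A2 ->
  sf_product m1 m2 (A1 `*` A2) = (m1 A1 * m2 A2)%E.
Proof. exact: product_measure1E. Qed.

End SigmaFiniteProduct.

(** * Fubini on a rectangle of finite measure *)

Section FubiniRectangle.
Context {d1 d2} {T1 : measurableType d1} {T2 : measurableType d2} {R : realType}.
Variables (m1 : {sigma_finite_measure set T1 -> \bar R}).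
Variables (m2 : {sigma_finite_measure set T2 -> \bar R}).
Variables (D1 : set T1) (D2 : set T2) (f : T1 * T2 -> R).
Hypotheses (mD1 : measurable D1) (mD2 : measurable D2).
Hypotheses (D1oo : (m1 D1 < +oo)%E) (D2oo : (m2 D2 < +oo)%E).
Hypothesis bf : bmf (D1 `*` D2) f.

Let mD12 : measurable (D1 `*` D2). Proof. exact: measurableX. Qed.
(** Extension by zero turns integrals over the rectangle into integrals over the whole product, the
    form in which Tonelli and Fubini are applied. *)
Let F := f \_ (D1 `*` D2).

Let iF : (m1 \x m2)%E.-integrable setT (EFin \o F).
Proof.
rewrite /F -restrict_EFin; apply/integrable_restrict => //.
rewrite setTI; apply: bmf_integrable => //.
by rewrite /= product_measure1E// lte_mul_pinfty// ge0_fin_numE.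
Qed.

Let FE x y : D1 x -> F (x, y) = ((fun y => f (x, y)) \_ D2) y.
Proof. by move=> D1x; rewrite /F !patchE in_setX mem_set. Qed.

Let FE2 x y : D2 y -> F (x, y) = ((fun x => f (x, y)) \_ D1) x.
Proof. by move=> D2y; rewrite /F !patchE in_setX [y \in _]mem_set// andbT. Qed.

Let Rint_section x : D1 x ->
  fubini_F m2 (EFin \o F) x = (\int[m2]_(y in D2) (f (x, y))%:E)%E.
Proof.
move=> D1x; rewrite integral_mkcond; apply: eq_integral => y _ /=.
by rewrite FE// !patchE; case: ifPn.
Qed.

Let Rint_section2 y : D2 y ->
  fubini_G m1 (EFin \o F) y = (\int[m1]_(x in D1) (f (x, y))%:E)%E.
Proof.
move=> D2y; rewrite integral_mkcond; apply: eq_integral => x _ /=.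
by rewrite FE2// !patchE; case: ifPn.
Qed.

Lemma bmf_section1 x : D1 x -> bmf D2 (fun y => f (x, y)).
Proof.
move=> D1x; split; last first.
  by have [_ [C fC]] := bf; exists C => y D2y; exact: fC.
suff : measurable_fun setT ((fun y => f (x, y)) \_ D2).
  by move/(measurable_restrict _ mD2 measurableT); rewrite setTI.
rewrite (_ : _ \_ _ = F \o pair x); last by apply/funext => y /=; rewrite -FE.
by apply: measurableT_comp; [exact: (bmf_restrict mD12 bf).1|].
Qed.

Lemma bmf_section2 y : D2 y -> bmf D1 (fun x => f (x, y)).
Proof.
move=> D2y; split; last first.
  by have [_ [C fC]] := bf; exists C => x D1x; exact: fC.
suff : measurable_fun setT ((fun x => f (x, y)) \_ D1).
  by move/(measurable_restrict _ mD1 measurableT); rewrite setTI.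
rewrite (_ : _ \_ _ = F \o pair^~ y); last by apply/funext => x /=; rewrite -FE2.
by apply: measurableT_comp; [exact: (bmf_restrict mD12 bf).1|].
Qed.

(** Measurability in the parameter is part of Fubini; the bound is that of [f] times the measure of
    [D2]. Thus iterated integrals stay within [bmf]. *)
Lemma bmf_Rintegral1 : bmf D1 (fun x => \int[m2]_(y in D2) f (x, y)).
Proof.
split.
  apply: (@eq_measurable_fun _ _ _ _ _ (fine \o fubini_F m2 (EFin \o F))).
    by move=> x /set_mem D1x; rewrite /= Rint_section.
  apply: measurable_funTS; apply: measurableT_comp => //.
  exact: (measurable_fubini_F iF).
have [_ [C fC]] := bf; exists (fine (`|C|%:E * m2 D2)%E) => x D1x.
have bx := bmf_section1 D1x.
rewrite -lee_fin EFin_normr_Rintegral//; last exact: bmf_integrable.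
apply: le_trans (le_abse_integral _ _ _) _ => //.
  by apply/measurable_EFinP; case: bx.
rewrite fineK; last first.
  by rewrite fin_numM// ge0_fin_numE.
rewrite -integral_cst//; apply: ge0_le_integral => //.
- by apply: measurableT_comp => //; apply/measurable_EFinP; case: bx.
- by move=> y D2y; rewrite /= lee_fin (le_trans (fC _ _)) ?ler_norm.
Qed.

Lemma Rintegral_rect12 : Rintegral (sf_product m1 m2) (D1 `*` D2) f =
  \int[m1]_(x in D1) \int[m2]_(y in D2) f (x, y).
Proof.
rewrite Rintegral_mkcond [RHS]Rintegral_mkcond; congr fine.
rewrite -(integral12_prod_meas1 iF); apply: eq_integral => x _.
rewrite patchE; case: ifPn => [/set_mem D1x|/negP D1x].
  rewrite Rint_section// fineK//; apply: integrable_fin_num => //.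
  exact/bmf_integrable/bmf_section1.
rewrite /fubini_F integral0_eq// => y _ /=; rewrite /F patchE in_setX.
by case: (x \in D1) D1x => // /(_ isT).
Qed.

Lemma Rintegral_rect21 : Rintegral (sf_product m1 m2) (D1 `*` D2) f =
  \int[m2]_(y in D2) \int[m1]_(x in D1) f (x, y).
Proof.
rewrite Rintegral_mkcond [RHS]Rintegral_mkcond; congr fine.
rewrite -(integral21_prod_meas1 iF); apply: eq_integral => y _.
rewrite patchE; case: ifPn => [/set_mem D2y|/negP D2y].
  rewrite Rint_section2// fineK//; apply: integrable_fin_num => //.
  exact/bmf_integrable/bmf_section2.
rewrite /fubini_G integral0_eq// => x _ /=; rewrite /F patchE in_setX.
by case: (y \in D2) D2y => [/(_ isT)|]//; rewrite andbF.
Qed.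

End FubiniRectangle.

(** * Integration over three-dimensional sets in coordinates *)

Section Coordinates.
Variable R : realType.
Local Notation V3 := 'rV[R]_3.
Local Notation T3 :=
  (measurableTypeR R * measurableTypeR R * measurableTypeR R)%type.
Local Notation leb1 := (@lebesgue_measure R).
Local Notation leb2 := (sf_product leb1 leb1).
Local Notation leb3 := (sf_product leb2 leb1).

Lemma measurable_vec3 (i : 'I_3) :
  measurable_fun setT (fun p : T3 => vec3 p 0 i).
Proof.
have m11 : measurable_fun setT (fun p : T3 => p.1.1).
  exact: (measurableT_comp (@measurable_fst _ _ _ _) (@measurable_fst _ _ _ _)).
have m12 : measurable_fun setT (fun p : T3 => p.1.2).
  exact: (measurableT_comp (@measurable_snd _ _ _ _) (@measurable_fst _ _ _ _)).
have m2 : measurable_fun setT (fun p : T3 => p.2) by exact: measurable_snd.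
under eq_fun do rewrite mxE.
by case: i => -[|[|[|]]].
Qed.

Lemma rat_approx (x : V3) (e : R) : 0 < e ->
  exists q : 'rV[rat]_3, ball x e (map_mx ratr q).
Proof.
move=> e0.
have hq i : exists q : rat, ball (x 0 i) e (ratr q : R).
  have /rat_in_itvoo [q] : x 0 i < x 0 i + e by rewrite ltrDl.
  rewrite in_itv /= => /andP[xq qx]; exists q.
  by rewrite /ball /= ltr_distlC; lra.
have [q qP] := choice hq.
by exists (\row_i q i); split=> // i j; rewrite !mxE ord1.
Qed.

Lemma borel_vec3 (U : set V3) : open U -> measurable (@vec3 R @^-1` U).
Proof.
apply: (borel_preimage rat_approx) => q r r0.
(* Balls of the sup norm are cubes, that is, intersections of coordinate conditions. *)
rewrite (_ : _ @^-1` _ = \bigcap_(i in [set: 'I_3])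
    ((fun p => vec3 p 0 i) @^-1` ball (map_mx ratr q 0 i : R) r)); last first.
  apply/seteqP; split => [p [_ h] i _|p h]; first exact: h.
  by split => // i j; rewrite ord1; exact: h.
apply: fin_bigcap_measurable => // i _; rewrite -[X in measurable X]setTI.
by apply: measurable_vec3 => //; apply: open_measurable; exact: ball_open.
Qed.

Lemma borel_vec33 (U : set (V3 * V3)) : open U ->
  measurable ((fun p : T3 * T3 => (vec3 p.1, vec3 p.2)) @^-1` U).
Proof.
pose q2 (q : 'rV[rat]_3 * 'rV[rat]_3) : V3 * V3 :=
  (map_mx ratr q.1, map_mx ratr q.2).
apply: (@borel_preimage _ _ _ _ _ q2) => [x e e0|q r r0].
  have [q xq] := rat_approx x.1 e0; have [q' xq'] := rat_approx x.2 e0.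
  by exists (q, q').
rewrite (_ : _ @^-1` _ = (@vec3 R @^-1` ball (map_mx ratr q.1 : V3) r) `*`
   (@vec3 R @^-1` ball (map_mx ratr q.2 : V3) r)); last first.
  by apply/seteqP; split => p [].
by apply: measurableX; apply: borel_vec3; exact: ball_open.
Qed.

Lemma normr_entry_le (x : V3) i : `|x 0 i| <= `|x|.
Proof.
rewrite [leRHS]/Num.Def.normr /= mx_normrE.
exact: (le_bigmax _ (fun ij => `|x ij.1 ij.2|) (0, i)).
Qed.

(** Enclosing a bounded set in a cube gives it finite measure and supplies the rectangle on which
    Fubini is applied. *)
Lemma bounded_sub_cube (A : set V3) : bounded_set A ->
  exists2 I : set (measurableTypeR R),
    measurable I /\ (lebesgue_measure I < +oo)%E &
    @vec3 R @^-1` A `<=` I `*` I `*` I.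
Proof.
move=> [M [_ MP]]; exists `[-(M + 1), M + 1]%classic.
  split; first exact: measurable_itv.
  by rewrite lebesgue_measure_itv /=; case: ifP => //; rewrite -EFinB ltry.
move=> p Ap.
have hp : `|vec3 p| <= M + 1 by apply: (MP (M + 1)) => //; rewrite ltrDl.
have hI i : `[-(M + 1), M + 1]%classic (vec3 p 0 i).
  rewrite /= in_itv /= -ler_norml (le_trans _ hp)//.
  exact: normr_entry_le.
split; first split.
- by have := hI 0; rewrite mxE.
- by have := hI 1; rewrite mxE.
- by have := hI (inord 2); rewrite mxE inordK.
Qed.

Lemma leb3_bounded (A : set V3) : measurable (@vec3 R @^-1` A) ->
  bounded_set A -> (leb3 (@vec3 R @^-1` A) < +oo)%E.
Proof.
move=> mA /bounded_sub_cube [I [mI Ioo] AI].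
apply: (@le_lt_trans _ _ (leb3 (I `*` I `*` I))).
  by apply: le_measure; rewrite ?inE//; do 2 apply: measurableX => //.
rewrite (_ : leb3 (I `*` I `*` I) =
    (lebesgue_measure I * lebesgue_measure I * lebesgue_measure I)%E).
  by rewrite !lte_mul_pinfty// ?fin_numM// ?mule_ge0// ge0_fin_numE.
rewrite sf_productE//; last exact: measurableX.
by congr (_ * _)%E; exact: sf_productE.
Qed.

Lemma eq_int3 (A : set V3) (g h : V3 -> R) :
  (forall x, A x -> g x = h x) -> int3 A g = int3 A h.
Proof. by move=> gh; apply: eq_Rintegral => p /set_mem; exact: gh. Qed.

Section Int3.
Variable A : set V3.
Hypotheses (mA : measurable (@vec3 R @^-1` A)) (bA : bounded_set A).
Implicit Types g h : V3 -> R.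

Let int3_integrable g : bmf (@vec3 R @^-1` A) (g \o @vec3 R) ->
  leb3.-integrable (@vec3 R @^-1` A) (EFin \o (g \o @vec3 R)).
Proof. by apply: bmf_integrable => //; exact: leb3_bounded. Qed.

Lemma int3D g h : bmf (@vec3 R @^-1` A) (g \o @vec3 R) ->
  bmf (@vec3 R @^-1` A) (h \o @vec3 R) ->
  int3 A (fun x => g x + h x) = int3 A g + int3 A h.
Proof. by move=> /int3_integrable ig /int3_integrable ih; exact: RintegralD. Qed.

Lemma int3B g h : bmf (@vec3 R @^-1` A) (g \o @vec3 R) ->
  bmf (@vec3 R @^-1` A) (h \o @vec3 R) ->
  int3 A (fun x => g x - h x) = int3 A g - int3 A h.
Proof. by move=> /int3_integrable ig /int3_integrable ih; exact: RintegralB. Qed.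

Lemma int3Z (c : R) g : bmf (@vec3 R @^-1` A) (g \o @vec3 R) ->
  int3 A (fun x => c * g x) = c * int3 A g.
Proof. by move=> /int3_integrable ig; exact: RintegralZl. Qed.

Lemma int3_0 : int3 A (fun=> 0) = 0.
Proof. exact: Rintegral0_eq. Qed.

Lemma int3_sum n (g : 'I_n -> V3 -> R) :
  (forall i, bmf (@vec3 R @^-1` A) (g i \o @vec3 R)) ->
  int3 A (fun x => \sum_i g i x) = \sum_i int3 A (g i).
Proof.
elim: n g => [|n IH] g bg.
  by rewrite big_ord0; under eq_fun do rewrite big_ord0; exact: int3_0.
under eq_fun do rewrite big_ord_recr.
rewrite int3D; [|exact: (bmf_sum (fun i => bg (widen_ord (leqnSn n) i)))|exact: bg].
by rewrite big_ord_recr /= IH.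
Qed.

(** By Fubini on an enclosing cube, with direction [i] integrated innermost, the integral over [A]
    is an iterated integral of integrals over slices of [A] parallel to axis [i]. *)
Lemma int3_slice0 g (i : 'I_3) :
  bmf (@vec3 R @^-1` A) (g \o @vec3 R) ->
  (forall v : V3, \int[@lebesgue_measure R]_(s in
       [set s | A (v + s *: (delta_mx 0 i : V3))])
       g (v + s *: (delta_mx 0 i : V3)) = 0) ->
  int3 A g = 0.
Proof.
move=> bg slice0.
have [I [mI Ioo] AI] := bounded_sub_cube bA.
pose F : T3 -> R := (g \o @vec3 R) \_ (@vec3 R @^-1` A).
have F0 p : ~ (I `*` I `*` I) p -> F p = 0.
  by move=> Ip; rewrite /F patchE memNset// => /AI.
have mII : measurable (I `*` I) by exact: measurableX.
have IIoo : (leb2 (I `*` I) < +oo)%E.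
  by rewrite sf_productE// lte_mul_pinfty// ge0_fin_numE.
have bF : bmf (I `*` I `*` I) F.
  have [mF [C FC]] := bmf_restrict mA bg.
  by split; [exact: measurable_funTS|exists C => t _; exact: FC].
have intF : int3 A g = Rintegral leb3 (I `*` I `*` I) F.
  rewrite /int3 Rintegral_mkcond -/F [RHS]Rintegral_mkcond.
  apply: eq_Rintegral => p _; rewrite [RHS]patchE; case: ifPn => //.
  by rewrite notin_setE => /F0.
(* [G] runs along a line parallel to axis [i]. Inside [I] the zero extension selects the slice of
   [A], and the slice cannot leave [I] because [A] lies in the cube. *)
have line (G : R -> T3) (v : V3) : (forall s, vec3 (G s) = v + s *: delta_mx 0 i) ->
    (forall s, (I `*` I `*` I) (G s) -> I s) ->
    (\int[@lebesgue_measure R]_(s in I) F (G s) = 0).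
  move=> vG IG; rewrite -(slice0 v) [RHS]Rintegral_mkcond Rintegral_mkcond.
  apply: eq_Rintegral => s _; rewrite !patchE; case: ifPn => [Is|].
    rewrite /F patchE; have [As|nAs] := pselect (A (v + s *: delta_mx 0 i)).
      by rewrite !mem_set//= vG.
    by rewrite !memNset//= vG.
  rewrite notin_setE => Is; case: ifPn => // /set_mem /= As; exfalso.
  by apply/Is/IG/AI; rewrite /= vG.
have vE (p : T3) (v : V3) (s : R) : (forall j : 'I_3, [:: p.1.1; p.1.2; p.2]`_j =
   v 0 j + s * (j == i)%:R) -> vec3 p = v + s *: delta_mx 0 i.
  by move=> h; apply/rowP => j; rewrite !mxE h eqxx.
rewrite intF.
(* The three coordinates differ only in the order of integration that puts coordinate [i] innermost:
   the outer variables are [p3], [p2], then [p3], [p1], then the pair [(p1, p2)]. The base point of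
   the line has coordinate [i] equal to 0. *)
clear slice0; case: i line vE => -[|[|[|//]]] hi line vE.
- apply: (etrans (Rintegral_rect21 (m1 := leb2) (m2 := leb1)
    mII mI IIoo Ioo bF)).
  apply: Rintegral0_eq => p3 Ip3.
  have bF3 := bmf_section2 mII mI bF Ip3.
  apply: (etrans (Rintegral_rect21 (m1 := leb1) (m2 := leb1)
    mI mI Ioo Ioo bF3)).
  apply: Rintegral0_eq => p2 Ip2.
  apply: (line (fun s => (s, p2, p3)) (vec3 (0, p2, p3))); last by move=> s [[]].
  by move=> s; apply: vE => -[[|[|[|//]]] hj]; rewrite !mxE/= ?eqE/=; ring.
- apply: (etrans (Rintegral_rect21 (m1 := leb2) (m2 := leb1)
    mII mI IIoo Ioo bF)).
  apply: Rintegral0_eq => p3 Ip3.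
  have bF3 := bmf_section2 mII mI bF Ip3.
  apply: (etrans (Rintegral_rect12 (m1 := leb1) (m2 := leb1)
    mI mI Ioo Ioo bF3)).
  apply: Rintegral0_eq => p1 Ip1.
  apply: (line (fun s => (p1, s, p3)) (vec3 (p1, 0, p3))); last by move=> s [[]].
  by move=> s; apply: vE => -[[|[|[|//]]] hj]; rewrite !mxE/= ?eqE/=; ring.
- apply: (etrans (Rintegral_rect12 (m1 := leb2) (m2 := leb1)
    mII mI IIoo Ioo bF)).
  apply: Rintegral0_eq => -[p1 p2] [Ip1 Ip2].
  apply: (line (fun s => (p1, p2, s)) (vec3 (p1, p2, 0))); last by move=> s [].
  by move=> s; apply: vE => -[[|[|[|//]]] hj]; rewrite !mxE/= ?eqE/=; ring.
Qed.

End Int3.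
Section Int3Fubini.
Variables A1 A2 : set V3.
Hypotheses (mA1 : measurable (@vec3 R @^-1` A1)) (bA1 : bounded_set A1).
Hypotheses (mA2 : measurable (@vec3 R @^-1` A2)) (bA2 : bounded_set A2).
Variable g : V3 -> V3 -> R.
Hypothesis bg : bmf ((@vec3 R @^-1` A1) `*` (@vec3 R @^-1` A2))
  (fun p : T3 * T3 => g (vec3 p.1) (vec3 p.2)).

Lemma bmf_int3 : bmf (@vec3 R @^-1` A1) ((fun x => int3 A2 (g x)) \o @vec3 R).
Proof.
exact: (bmf_Rintegral1 (m1 := leb3) (m2 := leb3) mA1 mA2
  (leb3_bounded mA1 bA1) (leb3_bounded mA2 bA2) bg).
Qed.

Lemma bmf_int3_section x : A1 x -> bmf (@vec3 R @^-1` A2) (g x \o @vec3 R).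
Proof.
(* The coordinate map is onto, so the section at [x] is a section at a point of the product
   space. *)
move=> A1x; pose p : T3 := (x 0 0, x 0 1, x 0 (inord 2)).
have px : vec3 p = x.
  apply/rowP => -[[|[|[|//]]] hj]; rewrite mxE /=; congr (x 0 _);
  by apply: val_inj; rewrite /= ?inordK.
have A1p : (@vec3 R @^-1` A1) p by rewrite /= px.
by have := bmf_section1 mA1 mA2 bg A1p; rewrite /= px.
Qed.

Lemma int3_Fubini : int3 A1 (fun x => int3 A2 (g x)) =
  int3 A2 (fun y => int3 A1 (g ^~ y)).
Proof.
have A1oo := leb3_bounded mA1 bA1; have A2oo := leb3_bounded mA2 bA2.
apply: (etrans (esym (Rintegral_rect12 (m1 := leb3) (m2 := leb3)
  mA1 mA2 A1oo A2oo bg))).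
exact: (Rintegral_rect21 (m1 := leb3) (m2 := leb3) mA1 mA2 A1oo A2oo bg).
Qed.

End Int3Fubini.

End Coordinates.

Lemma bounded_closure (R : realType) (V : normedModType R) (A : set V) :
  bounded_set A -> bounded_set (closure A).
Proof.
move=> [M [Mr MP]]; exists M; split=> // N MN x.
have cN : closed [set y : V | `|y| <= N].
  apply: (@closed_comp _ _ (fun y : V => `|y|) [set r : R | r <= N]).
    by move=> y _; exact: norm_continuous.
  exact: closed_le.
rewrite /= => Ax; have : closure [set y : V | `|y| <= N] x.
  by apply: closureS Ax => y Ay; exact: MP MN _ Ay.
by rewrite -(closure_id _).1.
Qed.

(** * The fundamental theorem of calculus on bounded open subsets of the line *)

Section OneDim.
Variable R : realType.
Implicit Types (h H : R -> R) (U : set R).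
Local Notation mu := (@lebesgue_measure R).

Lemma integral_derive0 H h (a b : R) : a < b ->
  {within `[a, b], continuous h} -> {within `[a, b], continuous H} ->
  (forall s, a < s < b -> is_derive s 1 H (h s)) -> H a = H b ->
  (\int[mu]_(s in `[a, b]) (h s)%:E = 0)%E.
Proof.
move=> ab ch cH dH Hab.
have [_ Ha Hb] := (continuous_within_itvP H ab).1 cH.
rewrite (@continuous_FTC2 _ _ H)//.
- by rewrite Hab subee.
- split=> // s; rewrite in_itv /= => /dH ds; exact: (@ex_derive _ _ _ _ _ _ _ ds).
- move=> s; rewrite in_itv /= => /dH ds.
  by rewrite derive1E; exact: (@derive_val _ _ _ _ _ _ _ ds).
Qed.

Lemma compact_closure_bounded U : bounded_set U -> compact (closure U).
Proof.
move=> /bounded_closure [M [_ MP]].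
apply: (subclosed_compact (@closed_closure _ U)
  (@segment_compact R (- (M + 1)) (M + 1))) => x Ux.
by rewrite /= in_itv /= -ler_norml; apply: (MP (M + 1)) => //; rewrite ltrDl.
Qed.

(** The interior of a bounded interval is the open interval between its infimum and supremum, and
    [U] is its own interior. *)
Lemma open_itvE U c : open U -> is_interval U -> bounded_set U -> U c ->
  exists a b, a < c < b /\ U = `]a, b[%classic.
Proof.
move=> oU iU [M [_ MP]] Uc; exists (inf U), (sup U).
have UM x : U x -> - (M + 1) <= x <= M + 1.
  by move=> Ux; rewrite -ler_norml; apply: (MP (M + 1)) => //; rewrite ltrDl.
have UE : U = [set r | inf U < r < sup U].
  rewrite -interval_bounded_interior//.
  - by apply/seteqP; split; [rewrite -open_subsetE|exact: interior_subset].
  - by exists (- (M + 1)) => x /UM /andP[].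
  - by exists (M + 1) => x /UM /andP[].
split; first by move: Uc; rewrite {1}UE.
by rewrite {1}UE; apply/seteqP; split => x; rewrite /= in_itv.
Qed.

(* A bounded open set is a disjoint union of countably many intervals whose
   endpoints lie on its boundary, where [H] vanishes. *)
Lemma Rintegral_derive0_open H h U : open U -> bounded_set U ->
  {within closure U, continuous h} -> {within closure U, continuous H} ->
  (forall s, U s -> is_derive s 1 H (h s)) ->
  (forall s, closure U s -> ~ U s -> H s = 0) ->
  \int[mu]_(s in U) h s = 0.
Proof.
move=> oU bU ch cH dH H0.
have mU : measurable (U : set (measurableTypeR R)) by exact: open_measurable.
have cU := compact_closure_bounded bU.
have mcU : measurable (closure U : set (measurableTypeR R)).
  exact: (compact_measurable cU).
have ihc : mu.-integrable (closure U) (EFin \o h).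
  exact: continuous_compact_integrable.
have ih := integrableS mcU mU (@subset_closure _ U) ihc.
pose I := open_disjoint_itv oU.
have UI : U = \bigcup_n I n by exact: open_disjoint_itv_bigcup.
have oI n : open (I n) by exact: open_disjoint_itv_open.
have tI : trivIset setT I by exact: open_disjoint_itv_trivIset.
have IU n : I n `<=` U by rewrite UI; exact: bigcup_sup.
(* Points of the component come arbitrarily close to its endpoint [c], so [c] is in the closure.
   Were [c] in [U], the open component containing it would meet [I n], hence equal it by
   disjointness, although an open interval misses its endpoints. *)
have endpoint n a b c : a < b -> I n = `]a, b[%classic -> (c = a \/ c = b) ->
    closure U c /\ ~ U c.
  move=> ab Inab cab.
  have near_c e : 0 < e -> exists2 x, I n x & ball c e x.
    (* A step of [e / 2] from the endpoint stays inside when the interval has length at least [e];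
       otherwise the midpoint is close enough. *)
    move=> e0; have [eab|abe] := lerP e (b - a).
      exists (if c == a then a + e / 2 else b - e / 2).
        by rewrite Inab /= in_itv /=; case: ifP => _; apply/andP; split; lra.
      rewrite /ball /= ltr_distlC.
      case: cab => ->; rewrite ?eqxx; first by apply/andP; split; lra.
      by rewrite gt_eqF//; apply/andP; split; lra.
    exists ((a + b) / 2); first by rewrite Inab /= in_itv /=; apply/andP; split; lra.
    by rewrite /ball /= ltr_distlC; case: cab => ->; apply/andP; split; lra.
  split.
    move=> B /nbhs_ballP [e /= e0 eB]; have [x Ix cx] := near_c e e0.
    by exists x; split; [exact: IU Ix|exact: eB].
  rewrite UI => -[m _ Imc].
  have /nbhs_ballP [e /= e0 eI] : nbhs c (I m) by exact: open_nbhs_nbhs.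
  have [x Inx cx] := near_c e e0.
  have mn : m = n by apply: tI => //; exists x; split => //; exact: eI.
  by move: Imc; rewrite mn Inab /= in_itv /=; case: cab => ->; rewrite ltxx ?andbF.
rewrite /Rintegral [X in integral _ X]UI integral_bigcup//.
- rewrite eseries0// => n _ _.
  have [->|/set0P [c Inc]] := eqVneq (I n) set0; first by rewrite integral_set0.
  have [a [b [/andP[ac cb] Inab]]] : exists a b, a < c < b /\ I n = `]a, b[%classic.
    apply: open_itvE => //; first exact: open_disjoint_itv_is_interval.
    have [M [Mr MP]] := bU.
    by exists M; split => // N MN x /IU; exact: MP.
  have ab : a < b := lt_trans ac cb.
  have [clUa nUa] := endpoint n a b a ab Inab (or_introl erefl).
  have [clUb nUb] := endpoint n a b b ab Inab (or_intror erefl).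
  have abU : `[a, b] `<=` closure U.
    move=> s; rewrite /= in_itv /= => /andP[].
    rewrite le_eqVlt => /predU1P[<- //|as_].
    rewrite le_eqVlt => /predU1P[-> //|sb]; apply/subset_closure/(IU n).
    by rewrite Inab /= in_itv /= as_ sb.
  have mh : measurable_fun `[a, b] (EFin \o h).
    apply: measurable_funS mcU abU _; exact: (measurable_int _ ihc).
  (* Adding the two endpoints does not change the integral, and the fundamental theorem is stated on
     the closed interval. *)
  rewrite Inab integral_itv_bndo_bndc; last first.
    by apply: measurable_funS mh => //; exact: subset_itv_oo_cc.
  rewrite integral_itv_obnd_cbnd; last first.
    by apply: measurable_funS mh => //; exact: subset_itv_oc_cc.
  apply: (@integral_derive0 H) => //.
  + exact: continuous_subspaceW ch.
  + exact: continuous_subspaceW cH.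
  + by move=> s sab; apply/dH/(IU n); rewrite Inab /= in_itv.
  + by rewrite !H0.
- by move=> n; exact: open_measurable.
- by rewrite -UI.
Qed.
End OneDim.

(** * Integrals of partial derivatives over open sets and over periodic boxes *)

Lemma within_comp (S T U : topologicalType) (phi : S -> T) (g : T -> U)
    (A : set T) (B : set S) :
  continuous phi -> B `<=` phi @^-1` A -> {within A, continuous g} ->
  {within B, continuous (g \o phi)}.
Proof.
move=> /continuousP cphi BA /continuousP cg; apply/continuousP => W oW.
have /cg/open_subspaceP [V oV VA] := oW.
apply/open_subspaceP; exists (phi @^-1` V); first exact: cphi.
apply/seteqP; split => s [hs Bs]; split => //=.
- have : (V `&` A) (phi s) by split => //; exact: BA.
  by rewrite VA => -[].
- have : (g @^-1` W `&` A) (phi s) by split => //; exact: BA.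
  by rewrite -VA => -[].
Qed.

Section DirectionalDerivative.
Variable R : realType.
Local Notation V3 := 'rV[R]_3.
Implicit Types (F dF : V3 -> R) (a b v : V3) (i : 'I_3).

(** The two difference quotients are the same function of the increment. *)
Lemma is_derive_line (V : normedModType R) (F : V -> R) (v e : V) (s l : R) :
  is_derive (v + s *: e) e F l -> is_derive s 1 (fun t : R => F (v + t *: e)) l.
Proof.
move=> [dF <-].
have quotE : (fun h : R => h^-1 *: (((fun t => F (v + t *: e)) \o shift s) (h *: 1)
      - F (v + s *: e))) =
    (fun h : R => h^-1 *: ((F \o shift (v + s *: e)) (h *: e) - F (v + s *: e))).
  apply/funext => h /=; congr (_ *: (F _ - _)).
  by rewrite /= [_ *: 1]mulr1 scalerDl addrCA.
by split; rewrite /derivable /derive quotE.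
Qed.

Lemma continuous_line (V : normedModType R) (v e : V) :
  continuous (fun t : R => v + t *: e).
Proof.
move=> t; apply: cvgD; first exact: cvg_cst.
by apply: cvgZl; exact: cvg_id.
Qed.

Lemma closure_line (V : normedModType R) (O : set V) (v e : V) t :
  closure [set t : R | O (v + t *: e)] t -> closure O (v + t *: e).
Proof.
move=> Ut B /(@continuous_line _ v e t) /Ut [s [Os Bs]].
by exists (v + s *: e).
Qed.

Lemma within_line (V : normedModType R) (O : set V) (F : V -> R) (v e : V) :
  {within closure O, continuous F} ->
  {within closure [set t : R | O (v + t *: e)],
    continuous (fun t : R => F (v + t *: e))}.
Proof.
by apply: within_comp; [exact: continuous_line|move=> t; exact: closure_line].
Qed.

(** This replaces the divergence theorem. Each slice of [O] is a bounded open subset of the line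
    whose closure maps into the closure of [O], so [F] vanishes at its boundary points and the
    one-dimensional case applies. *)
Lemma int3_partial0_open (O : set V3) F dF i : open O -> bounded_set O ->
  {within closure O, continuous F} -> {within closure O, continuous dF} ->
  (forall v, O v -> is_derive v (delta_mx 0 i : V3) F (dF v)) ->
  (forall v, closure O v -> ~ O v -> F v = 0) ->
  int3 O dF = 0.
Proof.
move=> oO bO cF cdF dFP F0.
have mO := borel_vec3 oO.
have cO : compact (closure O).
  by apply: bounded_closed_compact; [exact: bounded_closure|exact: closed_closure].
apply: (@int3_slice0 _ O mO bO dF i).
  apply: (bmf_within_comp (@borel_vec3 R) mO _ cO cdF).
  by move=> p Op; exact: subset_closure.
move=> v; apply: (@Rintegral_derive0_open _ (fun t => F (v + t *: delta_mx 0 i))).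
- by move/continuousP : (@continuous_line _ v (delta_mx 0 i : V3)); exact.
- have [M [Mr MP]] := bO.
  (* The parameter [t] is an entry of [t *: delta_mx 0 i], the difference of a point of [O] and [v],
     so it is bounded by [M] plus the norm of [v]. *)
  exists (M + `|v|); split; first exact: num_real.
  move=> N MN t Ot.
  have := MP (N - `|v|); rewrite ltrBrDr => /(_ MN _ Ot) hN.
  have := normr_entry_le (t *: delta_mx 0 i : V3) i.
  rewrite !mxE !eqxx mulr1 => /le_trans; apply.
  rewrite -[_ *: _](addKr v) addrC (le_trans (ler_normD _ _))// normrN.
  by rewrite -lerBrDr.
- exact: within_line.
- exact: within_line.
- by move=> s Os; apply: is_derive_line; exact: dFP.
- by move=> s Os nOs; apply: F0 => //; exact: closure_line.
Qed.

Lemma closed_box a b : closed (box a b).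
Proof.
rewrite (_ : box a b = \bigcap_(i in [set: 'I_3])
    ((fun x : V3 => x 0 i) @^-1` `[a 0 i, b 0 i])).
  apply: closed_bigI => i _; apply: closed_comp; last exact: interval_closed.
  by move=> x _; exact: coord_continuous.
apply/seteqP; split => x; first by move=> xab i _; rewrite /= in_itv /= xab.
by move=> xab i; have := xab i I; rewrite /= in_itv.
Qed.

Lemma bounded_box a b : bounded_set (box a b).
Proof.
exists (`|a| + `|b|); split; first exact: num_real.
move=> M abM x xab; rewrite /= [leLHS]/Num.Def.normr /= mx_normrE.
apply: bigmax_le => [|[j i] _ /=].
  by rewrite (le_trans _ (ltW abM))// addr_ge0.
rewrite ord1 (le_trans _ (ltW abM))//.
have /andP[ax xb] := xab i.
have := normr_entry_le a i; have := normr_entry_le b i.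
rewrite !ler_norml => /andP[_ b1] /andP[a1 _]; apply/andP; split.
  by have := normr_ge0 b; lra.
by have := normr_ge0 a; lra.
Qed.

Lemma compact_box a b : compact (box a b).
Proof. exact: (bounded_closed_compact (@bounded_box a b) (@closed_box a b)). Qed.

Lemma measurable_box a b : measurable (@vec3 R @^-1` box a b).
Proof.
have := measurableC (borel_vec3 (closed_openC (@closed_box a b))).
by rewrite -preimage_setC setCK.
Qed.

Lemma bmf_box a b F : continuous F -> bmf (@vec3 R @^-1` box a b) (F \o @vec3 R).
Proof.
move=> cF; apply: (bmf_within_comp (@borel_vec3 R) (measurable_box a b) _
  (@compact_box a b)); first by [].
exact: continuous_subspaceT.
Qed.

(** A slice of the box is either empty or a full segment spanning one period, and [F] takes equal
    values at its two ends. *)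
Lemma int3_partial0_box a b F dF i : (forall i, a 0 i < b 0 i) ->
  continuous dF -> (forall v, is_derive v (delta_mx 0 i : V3) F (dF v)) ->
  continuous F ->
  periodic F ((b 0 i - a 0 i) *: (delta_mx 0 i : V3)) ->
  int3 (box a b) dF = 0.
Proof.
move=> ab cdF dFP cF Fper.
apply: (@int3_slice0 _ _ (@measurable_box a b) (@bounded_box a b) dF i).
  exact: bmf_box.
move=> v; have [vab|vab] := pselect (forall j, j != i -> a 0 j <= v 0 j <= b 0 j).
  rewrite (_ : [set s | _] = `[a 0 i - v 0 i, b 0 i - v 0 i]%classic).
    apply: (congr1 fine (y := 0%E)).
    apply: (@integral_derive0 _ (fun t => F (v + t *: delta_mx 0 i))).
    + by rewrite ltrD2r.
    + apply: continuous_subspaceT => t; apply: continuous_comp; last exact: cdF.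
      exact: continuous_line.
    + apply: continuous_subspaceT => t; apply: continuous_comp; last exact: cF.
      exact: continuous_line.
    + by move=> s _; apply: is_derive_line; exact: dFP.
    + rewrite -[LHS]Fper -addrA -scalerDl; congr (F (_ + _ *: _)).
      by ring.
  apply/seteqP; split => s; rewrite /= in_itv /=.
    by move=> /(_ i); rewrite !mxE !eqxx mulr1; lra.
  move=> sab j; rewrite !mxE; have [->|ji] := eqVneq j i.
    by rewrite eqxx mulr1; lra.
  by rewrite eqxx /= mulr0 addr0 vab.
rewrite (_ : [set s | _] = set0) ?Rintegral_set0//.
apply/seteqP; split => // s /= sab; apply: vab => j ji.
by have := sab j; rewrite !mxE (negbTE ji) andbF mulr0 addr0.
Qed.

End DirectionalDerivative.

(** * Cyclic index arithmetic *)

Section Indices.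

Lemma sum3 (V : nmodType) (f : 'I_3 -> V) : \sum_(i < 3) f i = f 0 + f 1 + f 2.
Proof.
rewrite !big_ord_recl big_ord0 addr0 addrA.
by congr (_ + f _ + f _); exact: val_inj.
Qed.

(** The equations are packed in a tuple, so that a single [rewrite] can use all six as rules. *)
Lemma ord3E :
  ((0 + 1 = 1 :> 'I_3)%R * (0 + 2 = 2 :> 'I_3)%R * (1 + 1 = 2 :> 'I_3)%R *
   (1 + 2 = 0 :> 'I_3)%R * (2 + 1 = 0 :> 'I_3)%R * (2 + 2 = 1 :> 'I_3)%R)%type.
Proof. by do !split; exact: val_inj. Qed.

(* div (u x w) = (curl u) . w - u . (curl w), where [du i j] stands for the
   derivative of the component [j] of [u] in the direction [i]. *)
Lemma div_cross (R : comPzRingType) (u w : 'I_3 -> R) (du dw : 'I_3 -> 'I_3 -> R) :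
  \sum_(i < 3) (du (i + 1) (i + 2) - du (i + 2) (i + 1)) * w i -
  \sum_(i < 3) u i * (dw (i + 1) (i + 2) - dw (i + 2) (i + 1)) =
  \sum_(i < 3) (du i (i + 1) * w (i + 2) + u (i + 1) * dw i (i + 2) -
    (du i (i + 2) * w (i + 1) + u (i + 2) * dw i (i + 1))).
Proof. by rewrite !sum3 !ord3E; ring. Qed.

End Indices.

(** * Continuity and derivatives of components *)

Lemma continuous_withinT (V W : topologicalType) (G : V -> W) :
  {within setT, continuous G} -> continuous G.
Proof.
by rewrite (continuous_open_subspace _ openT) => cG x; exact: cG (in_setT x).
Qed.

Section RealContinuity.
Context {V : topologicalType} {R : realType}.
Implicit Types f g : V -> R.

Lemma continuous_addf f g : continuous f -> continuous g ->
  continuous (fun x => f x + g x).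
Proof. by move=> cf cg x; apply: cvgD; [exact: cf|exact: cg]. Qed.

Lemma continuous_subf f g : continuous f -> continuous g ->
  continuous (fun x => f x - g x).
Proof. by move=> cf cg x; apply: cvgB; [exact: cf|exact: cg]. Qed.

Lemma continuous_mulf f g : continuous f -> continuous g ->
  continuous (fun x => f x * g x).
Proof. by move=> cf cg x; apply: cvgM; [exact: cf|exact: cg]. Qed.

End RealContinuity.

Section Components.
Variable R : realType.
Local Notation V3 := 'rV[R]_3.

Lemma is_derive_entry (V : normedModType R) (F : V -> V3) (x d : V) l j :
  is_derive x d F l -> is_derive x d (fun y => F y 0 j) (l 0 j).
Proof.
move=> [dF <-]; split; first exact: ((derivable_mxP _ _ _).1 dF 0 j).
by rewrite derive_mx// mxE.
Qed.

Lemma is_derive_coord (v d : V3) j : is_derive v d (fun u : V3 => u 0 j) (d 0 j).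
Proof. exact: (is_derive_entry j (is_derive_id v d)). Qed.

(** Component [i] of [u x m] involves only the other two coordinates of [u], so the Lorentz force is
    constant in the direction of differentiation and only the factor [dot u u] contributes, by
    [2 * v 0 i]. *)
Lemma is_derive_force (e m v : V3) i : is_derive v (delta_mx 0 i : V3)
  (fun u => dot u u * (e 0 i + cross u m 0 i))
  (2 * v 0 i * (e 0 i + cross v m 0 i)).
Proof.
pose X j (u : V3) := u 0 j.
have dX j : is_derive v (delta_mx 0 i : V3) (X j) (j == i)%:R.
  have := is_derive_coord v (delta_mx 0 i) j; rewrite mxE eqxx; exact.
have dc (c : R) : is_derive v (delta_mx 0 i : V3) (cst c : V3 -> R) 0.
  exact: is_derive_cst.
have -> : (fun u => dot u u * (e 0 i + cross u m 0 i)) =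
    (\sum_(j < 3) X j * X j) *
    (cst (e 0 i) + (X (i + 1) * cst (m 0 (i + 2)) - X (i + 2) * cst (m 0 (i + 1)))).
  apply/funext => u; rewrite /= [RHS]/GRing.mul /= fct_sumE; congr (_ * _).
  by rewrite mxE.
have dM (f g : V3 -> R) df dg := @is_deriveM _ _ f g v (delta_mx 0 i : V3) df dg.
have d1 : is_derive v (delta_mx 0 i : V3) (\sum_(j < 3) X j * X j) (2 * v 0 i).
  apply: (is_derive_eq (is_derive_sum (fun j => dM _ _ _ _ (dX j) (dX j)))).
  rewrite (bigD1 i)//= big1 ?addr0; last first.
    by move=> j /negbTE ->; rewrite !scaler0 addr0.
  by rewrite eqxx /X /GRing.scale /=; ring.
apply: (is_derive_eq (dM _ _ _ _ d1 (is_deriveD (dc _) (is_deriveB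
  (dM _ _ _ _ (dX _) (dc _)) (dM _ _ _ _ (dX _) (dc _)))))).
have [-> ->] : (i + 1 == i) = false /\ (i + 2 == i) = false.
  by move: i {X dX dc dM d1}; case=> -[|[|[|//]]] hi; split; apply/eqP => /(congr1 val).
by rewrite !scaler0 !addr0 subrr addr0 scaler0 add0r mxE; exact: mulrC.
Qed.

Lemma continuous_entry (V : topologicalType) (F : V -> V3) j :
  continuous F -> continuous (fun x => F x 0 j).
Proof.
move=> cF x; apply: (@continuous_comp _ _ _ F (fun M : V3 => M 0 j)).
  exact: cF.
exact: coord_continuous.
Qed.

Lemma dot3 (u w : V3) : dot u w = u 0 0 * w 0 0 + u 0 1 * w 0 1 + u 0 2 * w 0 2.
Proof. exact: sum3. Qed.

Lemma continuous_dot (V : topologicalType) (F G : V -> V3) :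
  (forall j, continuous (fun x => F x 0 j)) ->
  (forall j, continuous (fun x => G x 0 j)) -> continuous (fun x => dot (F x) (G x)).
Proof.
move=> cF cG; under eq_fun do rewrite dot3.
by do ?apply: continuous_addf; apply: continuous_mulf; by [exact: cF|exact: cG].
Qed.

End Components.

(** * Symmetry of the curl on periodic fields *)

Section Fields.
Variable R : realType.
Local Notation V3 := 'rV[R]_3.
Variables (a b : V3).
Implicit Types F G : V3 -> V3.

(** The whole space is its own closure, so the continuous extensions in [C1_closure] are the partial
    derivatives themselves. *)
Lemma admissible_fieldE F : admissible_field a b F ->
  [/\ forall j, continuous (fun x => F x 0 j),
      forall i j, continuous (partial i (fun x => F x 0 j)),
      forall i j x, is_derive x (delta_mx 0 i : V3) (fun y => F y 0 j)
        (partial i (fun y => F y 0 j) x) &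
      forall i j, periodic (fun x => F x 0 j)
        ((b 0 i - a 0 i) *: (delta_mx 0 i : V3))].
Proof.
rewrite /admissible_field /C1_closure closureT.
move=> [[/continuous_withinT cF dF] pF].
have {}dF i : exists2 dFi : V3 -> V3, continuous dFi &
    forall x, is_derive x (delta_mx 0 i : V3) F (dFi x).
  have [dg /continuous_withinT cdg dgP] := dF (delta_mx 0 i : V3).
  by exists dg => // x; exact: dgP.
have part i j : exists2 dFi : V3 -> V3, continuous dFi &
    partial i (fun x => F x 0 j) = (fun x => dFi x 0 j).
  have [dFi cdFi dFiP] := dF i; exists dFi => //; apply/funext => x.
  have d := is_derive_entry j (dFiP x).
  exact: (@derive_val _ _ _ _ _ _ _ d).
split.
- by move=> j; exact: continuous_entry.
- by move=> i j; have [dFi cdFi ->] := part i j; exact: continuous_entry.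
- move=> i j x; have [dFi cdFi dFiP] := dF i.
  have d := is_derive_entry j (dFiP x).
  by rewrite /partial (@derive_val _ _ _ _ _ _ _ d).
- by move=> i j u; rewrite pF.
Qed.

Lemma continuous_curl F : admissible_field a b F ->
  forall j, continuous (fun x => curl F x 0 j).
Proof.
move=> /admissible_fieldE [_ cF _ _] j; under eq_fun do rewrite mxE.
by apply: continuous_subf; exact: cF.
Qed.

(** The difference of the integrands is the divergence of [F x G], which is periodic, so each of its
    three terms integrates to 0 over the box. *)
Lemma int3_curl_adjoint F G : (forall i, a 0 i < b 0 i) ->
  admissible_field a b F -> admissible_field a b G ->
  int3 (box a b) (fun x => dot (curl F x) (G x)) =
  int3 (box a b) (fun x => dot (F x) (curl G x)).
Proof.
move=> ab aF aG.
have [cF cdF dF pF] := admissible_fieldE aF.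
have [cG cdG dG pG] := admissible_fieldE aG.
have ccF := continuous_curl aF; have ccG := continuous_curl aG.
apply/eqP; rewrite -subr_eq0 -int3B; last 4 first.
- exact: measurable_box.
- exact: bounded_box.
- by apply: bmf_box; exact: continuous_dot.
- by apply: bmf_box; exact: continuous_dot.
(* [H i] is component [i] of [F x G], and [dH i] is its derivative in direction [i] by the product
   rule. *)
pose H i x := F x 0 (i + 1) * G x 0 (i + 2) - F x 0 (i + 2) * G x 0 (i + 1).
pose D i j (F : V3 -> V3) := partial i (fun y => F y 0 j).
pose dH i x := D i (i + 1) F x * G x 0 (i + 2) + F x 0 (i + 1) * D i (i + 2) G x
  - (D i (i + 2) F x * G x 0 (i + 1) + F x 0 (i + 2) * D i (i + 1) G x).
have cdH i : continuous (dH i).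
  by apply: continuous_subf; (apply: continuous_addf; apply: continuous_mulf);
    [exact: cdF|exact: cG|exact: cF|exact: cdG|exact: cdF|exact: cG|exact: cF|exact: cdG].
rewrite (_ : (fun x => _) = (fun x => \sum_(i < 3) dH i x)).
  rewrite int3_sum; last 3 first.
  - exact: measurable_box.
  - exact: bounded_box.
  - by move=> i; apply: bmf_box; exact: cdH.
  rewrite big1// => i _; apply: (@int3_partial0_box _ a b (H i)) => //.
  - move=> x.
    have dP j k := @is_deriveM _ _ _ _ _ _ _ _ (dF i j x) (dG i k x).
    apply: (is_derive_eq (is_deriveB (dP (i + 1) (i + 2)) (dP (i + 2) (i + 1)))).
    by rewrite /dH /D /GRing.scale /=; ring.
  - by apply: continuous_subf; apply: continuous_mulf;
      [exact: cF|exact: cG|exact: cF|exact: cG].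
  - by move=> x; rewrite /H !pF !pG.
apply/funext => x; rewrite -(div_cross (fun j => F x 0 j) (fun j => G x 0 j)
  (fun i j => D i j F x) (fun i j => D i j G x)).
by rewrite /dot; congr (_ - _); apply: eq_bigr => i _; rewrite mxE.
Qed.

End Fields.

(** * Densities on phase space *)

Lemma is_derive_fst (R : realType) (V W : normedModType R) (F : V * W -> R)
    (x d : V) (v : W) l :
  is_derive (x, v) (d, 0) F l -> is_derive x d (fun y => F (y, v)) l.
Proof.
move=> [dF <-].
have quotE : (fun h : R => h^-1 *: (((fun y => F (y, v)) \o shift x) (h *: d)
      - F (x, v))) =
    (fun h : R => h^-1 *: ((F \o shift (x, v)) (h *: (d, 0)) - F (x, v))).
  apply/funext => h /=; congr (_ *: (F _ - _)).
  by rewrite -[RHS]/(h *: d + x, h *: 0 + v) scaler0 add0r.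
by split; rewrite /derivable /derive quotE.
Qed.

Lemma is_derive_snd (R : realType) (V W : normedModType R) (F : V * W -> R)
    (x : V) (v d : W) l :
  is_derive (x, v) (0, d) F l -> is_derive v d (fun w => F (x, w)) l.
Proof.
move=> [dF <-].
have quotE : (fun h : R => h^-1 *: (((fun w => F (x, w)) \o shift v) (h *: d)
      - F (x, v))) =
    (fun h : R => h^-1 *: ((F \o shift (x, v)) (h *: (0, d)) - F (x, v))).
  apply/funext => h /=; congr (_ *: (F _ - _)).
  by rewrite -[RHS]/(h *: 0 + x, h *: d + v) scaler0 add0r.
by split; rewrite /derivable /derive quotE.
Qed.

Section PhaseSpace.
Variable R : realType.
Local Notation V3 := 'rV[R]_3.
Local Notation T3 :=
  (measurableTypeR R * measurableTypeR R * measurableTypeR R)%type.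
Variables (a b : V3) (Ov : set V3).
Hypotheses (ab : forall i, a 0 i < b 0 i) (oOv : open Ov) (bOv : bounded_set Ov).
Implicit Types (f g : V3 -> V3 -> R) (E B : V3 -> V3).

Local Notation Abox := (@vec3 R @^-1` box a b).
Local Notation AOv := (@vec3 R @^-1` Ov).
Local Notation phase h :=
  (fun p : T3 * T3 => h (vec3 p.1) (vec3 p.2)).

Lemma measurable_Ov : measurable AOv.
Proof. exact: borel_vec3. Qed.

Lemma compact_closure_Ov : compact (closure Ov).
Proof.
by apply: bounded_closed_compact; [exact: bounded_closure|exact: closed_closure].
Qed.

Lemma closure_setTX x v : closure Ov v -> closure ([set: V3] `*` Ov) (x, v).
Proof.
move=> clv A [[P Q] /= [xP vQ] PQA]; have [w [Ow Qw]] := clv _ vQ.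
by exists (x, w); split => //; apply: PQA; split => //; exact: nbhs_singleton.
Qed.

(** Only the product of the box and the closure of [Ov] matters here. It is compact, so continuity
    there gives boundedness. *)
Lemma bmf_phase (h : V3 * V3 -> R) :
  {within closure (setT `*` Ov), continuous h} ->
  bmf (Abox `*` AOv) (phase (fun x v => h (x, v))).
Proof.
move=> ch; have cb : compact (box a b `*` closure Ov).
  by apply: compact_setX; [exact: compact_box|exact: compact_closure_Ov].
apply: (bmf_within_comp (@borel_vec33 R) _ _ cb).
- apply: measurableX; [exact: measurable_box|exact: measurable_Ov].
- by move=> [p q] [/= pb qO]; split => //=; exact: subset_closure.
- by apply: continuous_subspaceW ch => -[x v] [_ /=]; exact: closure_setTX.
Qed.

Lemma bmf_phase_x (h : V3 -> R) : continuous h ->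
  bmf (Abox `*` AOv) (phase (fun x _ => h x)).
Proof.
move=> ch; apply: (bmf_phase (h := h \o fst)); apply: continuous_subspaceT => p.
by apply: continuous_comp; [exact: cvg_fst|exact: ch].
Qed.

Lemma bmf_phase_v (h : V3 -> R) : continuous h ->
  bmf (Abox `*` AOv) (phase (fun _ v => h v)).
Proof.
move=> ch; apply: (bmf_phase (h := h \o snd)); apply: continuous_subspaceT => p.
by apply: continuous_comp; [exact: cvg_snd|exact: ch].
Qed.

(** The phase space directions [(e_i, 0)] and [(0, e_i)] yield the partial derivatives in x and in
    v, with representatives jointly continuous up to the boundary. *)
Lemma admissible_densityE f : admissible_density a b Ov f ->
  {within closure (setT `*` Ov), continuous (fun p => f p.1 p.2)} /\
  exists Dx Dv : 'I_3 -> V3 * V3 -> R,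
  [/\ forall i, {within closure (setT `*` Ov), continuous Dx i},
      forall i, {within closure (setT `*` Ov), continuous Dv i},
      forall i x v, Ov v -> is_derive x (delta_mx 0 i : V3) (f ^~ v) (Dx i (x, v)) &
      forall i x v, Ov v -> is_derive v (delta_mx 0 i : V3) (f x) (Dv i (x, v))].
Proof.
move=> [[cf df] _ _]; split => //.
have hx i : exists D : V3 * V3 -> R, {within closure (setT `*` Ov), continuous D} /\
    forall p, (setT `*` Ov) p ->
      is_derive p (delta_mx 0 i : V3, 0 : V3) (fun p => f p.1 p.2) (D p).
  by have [D cD DP] := df (delta_mx 0 i : V3, 0 : V3); exists D.
have hv i : exists D : V3 * V3 -> R, {within closure (setT `*` Ov), continuous D} /\
    forall p, (setT `*` Ov) p ->
      is_derive p (0 : V3, delta_mx 0 i : V3) (fun p => f p.1 p.2) (D p).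
  by have [D cD DP] := df (0 : V3, delta_mx 0 i : V3); exists D.
have [Dx DxP] := choice hx; have [Dv DvP] := choice hv.
exists Dx, Dv; split=> [i|i|i x v Ovv|i x v Ovv].
- by have [] := DxP i.
- by have [] := DvP i.
- have [_ /(_ (x, v) (conj I Ovv))] := DxP i; exact: is_derive_fst.
- have [_ /(_ (x, v) (conj I Ovv))] := DvP i; exact: is_derive_snd.
Qed.

End PhaseSpace.

(** * The kinetic energy moment of the transport term *)

Section Kinetic.
Variable R : realType.
Local Notation V3 := 'rV[R]_3.
Local Notation T3 :=
  (measurableTypeR R * measurableTypeR R * measurableTypeR R)%type.
Variables (a b : V3) (Ov : set V3).
Hypotheses (ab : forall i, a 0 i < b 0 i) (oOv : open Ov) (bOv : bounded_set Ov).
Implicit Types (f g : V3 -> V3 -> R) (E B : V3 -> V3).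

Local Notation Abox := (@vec3 R @^-1` box a b).
Local Notation AOv := (@vec3 R @^-1` Ov).
Local Notation phase h :=
  (fun p : T3 * T3 => h (vec3 p.1) (vec3 p.2)).

Let mOv : measurable AOv. Proof. exact: borel_vec3. Qed.
Lemma bmf_Ov (h : V3 -> R) : {within closure Ov, continuous h} ->
  bmf AOv (h \o @vec3 R).
Proof.
move=> ch; apply: (bmf_within_comp (@borel_vec3 R) mOv _ (compact_closure_Ov bOv) ch).
by move=> p Op; exact: subset_closure.
Qed.

Lemma within_section (h : V3 * V3 -> R) x :
  {within closure (setT `*` Ov), continuous h} ->
  {within closure Ov, continuous (fun v => h (x, v))}.
Proof.
apply: (@within_comp _ _ _ (pair x)); last by move=> v; exact: closure_setTX.
move=> v A [[P Q] /= [xP vQ] PQA]; apply: (filterS _ vQ) => w Qw.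
by apply: PQA; split => //; exact: nbhs_singleton.
Qed.

Lemma within_section_x (h : V3 * V3 -> R) v : Ov v ->
  {within closure (setT `*` Ov), continuous h} -> continuous (fun x => h (x, v)).
Proof.
move=> Ovv ch; apply: continuous_withinT.
apply: (@within_comp _ _ _ (pair^~ v) _ _ _ _ _ ch).
  move=> x A [[P Q] /= [xP vQ] PQA]; apply: (filterS _ xP) => w Pw.
  by apply: PQA; split => //; exact: nbhs_singleton.
by move=> x _; apply: closure_setTX; exact: subset_closure.
Qed.

(** Continuity within a set is continuity for the subspace topology, so the results on continuous
    functions transfer. *)
Let within_mul (h k : V3 -> R) : {within closure Ov, continuous h} ->
  {within closure Ov, continuous k} ->
  {within closure Ov, continuous (fun v => h v * k v)}.
Proof. exact: (@continuous_mulf (subspace (closure Ov))). Qed.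

Let within_add (h k : V3 -> R) : {within closure Ov, continuous h} ->
  {within closure Ov, continuous k} ->
  {within closure Ov, continuous (fun v => h v + k v)}.
Proof. exact: (@continuous_addf (subspace (closure Ov))). Qed.

Lemma continuous_lorentz (e m : V3) i :
  continuous (fun v : V3 => e 0 i + cross v m 0 i).
Proof.
have cc j : continuous (fun v : V3 => v 0 j) by exact: coord_continuous.
apply: continuous_addf; first by exact: cst_continuous.
under eq_fun do rewrite mxE.
by apply: continuous_subf; apply: continuous_mulf => //; exact: cst_continuous.
Qed.

Lemma continuous_dotvv : continuous (fun v : V3 => dot v v).
Proof. by apply: (continuous_dot (F := id) (G := id)); exact: coord_continuous. Qed.

Lemma continuous_force (e m : V3) i :
  continuous (fun v : V3 => dot v v * (e 0 i + cross v m 0 i)).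
Proof.
by apply: continuous_mulf; [exact: continuous_dotvv|exact: continuous_lorentz].
Qed.

(* The magnetic force does no work, since v . (v x m) = 0. *)
Lemma work_force f (Dv : 'I_3 -> V3 -> R) (e m x : V3) :
  {within closure Ov, continuous (f x)} ->
  (forall i, {within closure Ov, continuous (Dv i)}) ->
  (forall i v, Ov v -> is_derive v (delta_mx 0 i : V3) (f x) (Dv i v)) ->
  (forall v, closure Ov v -> ~ Ov v -> f x v = 0) ->
  int3 Ov (fun v => \sum_(i < 3) Dv i v * (dot v v * (e 0 i + cross v m 0 i))) =
  - (2 * dot e (current Ov f x)).
Proof.
move=> cf cDv dDv f0.
pose w i (v : V3) := dot v v * (e 0 i + cross v m 0 i).
pose dw i (v : V3) := 2 * v 0 i * (e 0 i + cross v m 0 i).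
have cw i : {within closure Ov, continuous (w i)}.
  by apply: continuous_subspaceT; exact: continuous_force.
have cdw i : {within closure Ov, continuous (dw i)}.
  apply: continuous_subspaceT; apply: continuous_mulf.
    by apply: continuous_mulf; [exact: cst_continuous|exact: coord_continuous].
  exact: continuous_lorentz.
have cv i : {within closure Ov, continuous (fun v : V3 => v 0 i)}.
  by apply: continuous_subspaceT; exact: coord_continuous.
(* [Q i] is the derivative in direction [i] of [f x v * w i v], which vanishes on the boundary of
   [Ov] with [f]; hence its integral is 0. *)
pose Q i v := Dv i v * w i v + f x v * dw i v.
have cQ i : {within closure Ov, continuous (Q i)}.
  by apply: within_add; apply: within_mul; [exact: cDv|exact: cw|exact: cf|exact: cdw].
have int0 i : int3 Ov (Q i) = 0.
  apply: (@int3_partial0_open _ Ov (fun v => f x v * w i v) _ i) => //.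
  - exact: within_mul.
  - move=> v Ovv.
    apply: (is_derive_eq (is_deriveM (dDv i v Ovv) (is_derive_force e m v i))).
    by rewrite /Q /w /dw /GRing.scale /=; ring.
  - by move=> v clv nv; rewrite f0// mul0r.
have bf := bmf_Ov cf.
have bQ i : bmf AOv (Q i \o @vec3 R) by exact: bmf_Ov.
have bfv i : bmf AOv ((fun v => f x v * v 0 i) \o @vec3 R).
  by apply: bmf_Ov; exact: within_mul.
have bfve : bmf AOv ((fun v => \sum_(i < 3) e 0 i * (f x v * v 0 i)) \o @vec3 R).
  exact: (bmf_sum (fun i => bmfZ (e 0 i) (bfv i))).
have : int3 Ov (fun v => \sum_(i < 3) Q i v) = 0.
  by rewrite int3_sum// big1.
(* In the sum of the [f x v * dw i v] the magnetic terms cancel, which leaves [2 * f x v] times the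
   dot product of [e] and [v]. *)
rewrite (@eq_int3 _ _ _ (fun v => \sum_(i < 3) Dv i v * w i v +
  2 * \sum_(i < 3) e 0 i * (f x v * v 0 i))); last first.
  move=> v _; rewrite !sum3 /Q /dw !mxE !ord3E; ring.
rewrite int3D//; last 2 first.
- exact: (bmf_sum (fun i => bmfM (bmf_Ov (cDv i)) (bmf_Ov (cw i)))).
- exact: (bmfZ 2 bfve).
rewrite (int3Z mOv bOv 2 bfve).
rewrite (int3_sum mOv bOv (fun i => bmfZ (e 0 i) (bfv i))).
move=> /eqP; rewrite addr_eq0 => /eqP ->; congr (- (_ * _)).
by apply: eq_bigr => i _; rewrite (int3Z mOv bOv _ (bfv i)) mxE.
Qed.

Lemma bmf_current f j : admissible_density a b Ov f ->
  bmf Abox ((fun x => current Ov f x 0 j) \o @vec3 R).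
Proof.
move=> /admissible_densityE [cf _].
have bfv : bmf (Abox `*` AOv) (phase (fun x v => f x v * v 0 j)).
  apply: bmfM; first exact: (bmf_phase a b oOv bOv cf).
  by apply: (bmf_phase_v a b oOv bOv (h := fun v => v 0 j)); exact: coord_continuous.
under eq_fun do rewrite mxE.
exact: (bmf_int3 (@measurable_box R a b) (@bounded_box R a b) mOv bOv bfv).
Qed.

Lemma bmf_dot_current f E : admissible_density a b Ov f ->
  (forall j, continuous (fun x => E x 0 j)) ->
  bmf Abox ((fun x => dot (E x) (current Ov f x)) \o @vec3 R).
Proof.
move=> af cE; apply: (bmf_sum (f := fun i =>
  (fun x => E x 0 i * current Ov f x 0 i) \o @vec3 R)) => i.
exact: (bmfM (bmf_box a b (cE i)) (bmf_current i af)).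
Qed.

(** The integrand splits into a streaming part [A], killed by periodicity in x, and a force part
    [W], evaluated by [work_force]. The same splitting yields the bounded measurability needed to
    integrate the Vlasov step. *)
Lemma kinetic_transport f E B : admissible_density a b Ov f ->
  (forall j, continuous (fun x => E x 0 j)) ->
  (forall j, continuous (fun x => B x 0 j)) ->
  bmf (Abox `*` AOv) (phase (fun x v => transport f E B x v * dot v v)) /\
  int3 (box a b) (fun x => int3 Ov (fun v => transport f E B x v * dot v v)) =
  - (2 * int3 (box a b) (fun x => dot (E x) (current Ov f x))).
Proof.
move=> af cE cB; have [cf [Dx [Dv [cDx cDv dDx dDv]]]] := admissible_densityE af.
have [_ pf f0] := af.
pose A x v := \sum_(i < 3) (dot v v * v 0 i) * Dx i (x, v).
pose W x v := \sum_(i < 3) Dv i (x, v) * (dot v v * (E x 0 i + cross v (B x) 0 i)).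
have tE x v : Ov v -> transport f E B x v * dot v v = A x v + W x v.
  move=> Ovv; rewrite /A /W -big_split /= /transport mulrDl /dot mulr_suml.
  rewrite mulr_suml -big_split /=; apply: eq_bigr => i _.
  have dx := dDx i x v Ovv; have dv := dDv i x v Ovv.
  rewrite !mxE /partial (@derive_val _ _ _ _ _ _ _ dx) (@derive_val _ _ _ _ _ _ _ dv).
  by ring.
have mb := @measurable_box R a b; have bb := @bounded_box R a b.
have bvv : bmf (Abox `*` AOv) (phase (fun _ v => dot v v)).
  exact: (bmf_phase_v a b oOv bOv continuous_dotvv).
have bv i : bmf (Abox `*` AOv) (phase (fun _ v => v 0 i)).
  by apply: (bmf_phase_v a b oOv bOv (h := fun v => v 0 i)); exact: coord_continuous.
have bE i : bmf (Abox `*` AOv) (phase (fun x _ => E x 0 i)).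
  exact: (bmf_phase_x a b oOv bOv (cE i)).
have bB i : bmf (Abox `*` AOv) (phase (fun x _ => B x 0 i)).
  exact: (bmf_phase_x a b oOv bOv (cB i)).
have bA : bmf (Abox `*` AOv) (phase A).
  by apply: bmf_sum => i; do ?apply: bmfM => //; exact: (bmf_phase a b oOv bOv (cDx i)).
have bW : bmf (Abox `*` AOv) (phase W).
  apply: bmf_sum => i; apply: bmfM; first exact: (bmf_phase a b oOv bOv (cDv i)).
  apply: bmfM => //; apply: bmfD => //.
  by under eq_fun do rewrite mxE; apply: bmfB; apply: bmfM.
split.
  apply: (eq_bmf _ (bmfD bA bW)) => p /set_mem [_ Op] /=.
  by rewrite tE.
rewrite (@eq_int3 _ _ _ (fun x => int3 Ov (A x) + int3 Ov (W x))); last first.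
  move=> x bx; rewrite -(int3D mOv bOv).
  - by apply: eq_int3 => v Ovv; exact: tE.
  - exact: (bmf_int3_section mb mOv bA bx).
  - exact: (bmf_int3_section mb mOv bW bx).
rewrite (int3D mb bb (bmf_int3 mb bb mOv bOv bA) (bmf_int3 mb bb mOv bOv bW)).
(* For the streaming part x is integrated first: at fixed [v] the weight [dot v v * v 0 i] is a
   constant, and the x-derivative of a periodic function remains. *)
rewrite (int3_Fubini mb bb mOv bOv bA).
rewrite [X in X + _](_ : _ = 0) ?add0r; last first.
  rewrite -[RHS](int3_0 Ov); apply: eq_int3 => v Ovv.
  have cDxv i : continuous (fun x => Dx i (x, v)).
    exact: (within_section_x Ovv (cDx i)).
  rewrite (int3_sum mb bb (fun i => bmfZ _ (bmf_box a b (cDxv i)))).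
  rewrite big1// => i _; rewrite (int3Z mb bb _ (bmf_box a b (cDxv i))).
  rewrite (_ : int3 _ _ = 0) ?mulr0//.
  apply: (@int3_partial0_box _ a b (f ^~ v) _ i) => //.
  - by move=> x; exact: dDx.
  - exact: (within_section_x Ovv cf).
  - by apply: pf; exact: subset_closure.
rewrite (@eq_int3 _ _ _ (fun x => (- 2) * dot (E x) (current Ov f x))); last first.
  move=> x bx; rewrite mulNr -(@work_force f (fun i v => Dv i (x, v)) _ (B x))//.
  - exact: (within_section (x := x) cf).
  - by move=> i; exact: (within_section (x := x) (cDv i)).
  - by move=> v clv nv; apply: f0; split => // /interior_subset.
by rewrite (int3Z mb bb _ (bmf_dot_current af cE)) mulNr.
Qed.

End Kinetic.

(** * Linear combinations of admissible fields and densities *)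

Section LinearCombinations.
Variable R : realType.
Local Notation V3 := 'rV[R]_3.

Lemma C1_closure_lin (V W : normedModType R) (O : set V) (F G : V -> W) (c d : R) :
  C1_closure O F -> C1_closure O G -> C1_closure O (fun p => c *: F p + d *: G p).
Proof.
have cl (h k : V -> W) : {within closure O, continuous h} ->
    {within closure O, continuous k} ->
    {within closure O, continuous (fun p => c *: h p + d *: k p)}.
  move=> ch ck p; apply: (@cvgD R W (subspace (closure O))).
    by apply: cvgZr; exact: ch.
  by apply: cvgZr; exact: ck.
move=> [cF dF] [cG dG]; split; first exact: cl.
move=> e; have [F' cF' F'P] := dF e; have [G' cG' G'P] := dG e.
exists (fun p => c *: F' p + d *: G' p); first exact: cl.
move=> p Op; have F'p := F'P p Op; have G'p := G'P p Op.
exact: (is_deriveD (is_deriveZ c F'p) (is_deriveZ d G'p)).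
Qed.

Variables (a b : V3) (Ov : set V3).
Implicit Types (f g : V3 -> V3 -> R) (F G : V3 -> V3).

Lemma admissible_field_lin F G (c d : R) : admissible_field a b F ->
  admissible_field a b G -> admissible_field a b (fun x => c *: F x + d *: G x).
Proof.
move=> [cF pF] [cG pG]; split; first exact: C1_closure_lin.
by move=> i x; rewrite pF pG.
Qed.

Lemma admissible_mean_field F G : admissible_field a b F ->
  admissible_field a b G -> admissible_field a b (mean_field F G).
Proof.
move=> aF aG; have := admissible_field_lin 2^-1 2^-1 aF aG.
by congr admissible_field; apply/funext => x; rewrite /mean_field scalerDr.
Qed.

Lemma admissible_prev_half (F Fh : nat -> V3 -> V3) n :
  (forall n, admissible_field a b (F n)) ->
  (forall n, admissible_field a b (Fh n)) ->
  admissible_field a b (prev_half F Fh n).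
Proof.
move=> aF aFh; case: n => [|m]; last exact: aFh.
have := admissible_field_lin 2 (-1) (aF 0%N) (aFh 0%N).
by congr admissible_field; apply/funext => x; rewrite scaleN1r.
Qed.

Lemma admissible_mean_density f g : admissible_density a b Ov f ->
  admissible_density a b Ov g -> admissible_density a b Ov (mean_density f g).
Proof.
move=> [cf pf f0] [cg pg g0]; split.
- have := C1_closure_lin 2^-1 2^-1 cf cg.
  by congr C1_closure; apply/funext => p; rewrite /mean_density mulrDr.
- by move=> v clv i x; rewrite /mean_density pf// pg.
- by move=> x v bv; rewrite /mean_density f0// g0// addr0 mulr0.
Qed.

Lemma curl_mean_field F G x : admissible_field a b F -> admissible_field a b G ->
  curl (mean_field F G) x = 2^-1 *: (curl F x + curl G x).
Proof.
move=> /admissible_fieldE [_ _ dF _] /admissible_fieldE [_ _ dG _].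
have pM i j : partial i (fun y => mean_field F G y 0 j) x =
    2^-1 * (partial i (fun y => F y 0 j) x + partial i (fun y => G y 0 j) x).
  have d := is_deriveZ 2^-1 (is_deriveD (dF i j x) (dG i j x)).
  rewrite -[RHS](@derive_val _ _ _ _ _ _ _ d) /partial; congr ('D_ _ _ x).
  by apply/funext => y; rewrite !mxE.
by apply/rowP => i; rewrite !mxE !pM; ring.
Qed.

(** The current is linear in the density because the moments [f x v * v 0 i] are bounded and
    measurable over [Ov], hence integrable. *)
Lemma current_mean_density f g x : open Ov -> bounded_set Ov ->
  admissible_density a b Ov f -> admissible_density a b Ov g ->
  current Ov (mean_density f g) x = 2^-1 *: (current Ov f x + current Ov g x).
Proof.
move=> oOv bOv /admissible_densityE [cf _] /admissible_densityE [cg _].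
have mOv := borel_vec3 oOv.
have bmf_fv (h : V3 -> V3 -> R) i :
    {within closure (setT `*` Ov), continuous (fun p => h p.1 p.2)} ->
    bmf (@vec3 R @^-1` Ov) ((fun v => h x v * v 0 i) \o @vec3 R).
  move=> /(within_section (x := x)) ch; apply: (bmfM (bmf_Ov oOv bOv ch)).
  split; first exact: measurable_funTS (measurable_vec3 i).
  have [M [_ MP]] := bOv; exists (M + 1) => p Op.
  by rewrite (le_trans (normr_entry_le _ _))//; apply: (MP (M + 1)) => //; rewrite ltrDl.
apply/rowP => i; rewrite !mxE.
have bf := bmf_fv f i cf; have bg := bmf_fv g i cg.
rewrite -(int3D mOv bOv bf bg) -(int3Z mOv bOv _ (bmfD bf bg)).
by apply: eq_int3 => v _; rewrite /mean_density; ring.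
Qed.

End LinearCombinations.

(** * Identities for the dot product *)

Section Dot.
Variable R : realType.
Implicit Types (u w z : 'rV[R]_3).

Lemma dotC u w : dot u w = dot w u.
Proof. by apply: eq_bigr => i _; rewrite mulrC. Qed.

Lemma dotZl c u z : dot (c *: u) z = c * dot u z.
Proof. by rewrite !dot3 !mxE; ring. Qed.

Lemma dotBl u w z : dot (u - w) z = dot u z - dot w z.
Proof. by rewrite !dot3 !mxE; ring. Qed.

Lemma dotNl u z : dot (- u) z = - dot u z.
Proof. by rewrite -scaleN1r dotZl mulN1r. Qed.

Lemma dot_sqrB u w : dot w w - dot u u = dot (w - u) (u + w).
Proof. by rewrite !dot3 !mxE; ring. Qed.

Lemma dotDB u w : dot (u - w) (u + w) = dot u u - dot w w.
Proof. by rewrite !dot3 !mxE; ring. Qed.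

End Dot.

(** * Energy balance of one time step *)

Section EnergyBalance.
Variable R : realType.
Local Notation V3 := 'rV[R]_3.
Variables (a b : V3) (Ov : set V3) (dt : R).
Hypotheses (ab : forall i, a 0 i < b 0 i) (oOv : open Ov) (bOv : bounded_set Ov).
Hypothesis dt0 : 0 < dt.
Implicit Types (f g : V3 -> V3 -> R) (E B : V3 -> V3).

Local Notation Abox := (@vec3 R @^-1` box a b).

Let mOv := borel_vec3 oOv.
Let mb := @measurable_box R a b.
Let bb := @bounded_box R a b.

(** Here [g], [E] and [B] are whatever density and fields drive the step, at half steps or as means,
    so one statement serves all four schemes. *)
Lemma kinetic2_step f f' g E B :
  admissible_density a b Ov f -> admissible_density a b Ov f' ->
  admissible_density a b Ov g ->
  admissible_field a b E -> admissible_field a b B ->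
  (forall x v, Ov v -> (f' x v - f x v) / dt + transport g E B x v = 0) ->
  kinetic2 a b Ov f' - kinetic2 a b Ov f =
  2 * dt * int3 (box a b) (fun x => dot (E x) (current Ov g x)).
Proof.
move=> af af' ag /admissible_fieldE [cE _ _ _] /admissible_fieldE [cB _ _ _] step.
have bk h : admissible_density a b Ov h ->
    bmf (Abox `*` (@vec3 R @^-1` Ov))
      (fun p => h (vec3 p.1) (vec3 p.2) * dot (vec3 p.2) (vec3 p.2)).
  move=> /admissible_densityE [ch _].
  apply: (bmfM (bmf_phase a b oOv bOv ch)).
  exact: (bmf_phase_v a b oOv bOv (@continuous_dotvv R)).
have bf := bk f af; have bf' := bk f' af'.
have [bT intT] := kinetic_transport ab oOv bOv ag cE cB.
rewrite /kinetic2 -(int3B mb bb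
  (bmf_int3 (g := fun x v => f' x v * dot v v) mb bb mOv bOv bf')
  (bmf_int3 (g := fun x v => f x v * dot v v) mb bb mOv bOv bf)).
rewrite (@eq_int3 _ _ _
  (fun x => - dt * int3 Ov (fun v => transport g E B x v * dot v v))).
  rewrite (int3Z mb bb _ (bmf_int3 (g := fun x v => transport g E B x v * dot v v)
    mb bb mOv bOv bT)) intT.
  ring.
move=> x bx.
have bfx := bmf_int3_section (g := fun x v => f x v * dot v v) mb mOv bf bx.
have bfx' := bmf_int3_section (g := fun x v => f' x v * dot v v) mb mOv bf' bx.
have bTx := bmf_int3_section (g := fun x v => transport g E B x v * dot v v) mb mOv bT bx.
rewrite -(int3B mOv bOv bfx' bfx) -(int3Z mOv bOv _ bTx).
apply: eq_int3 => v Ovv; rewrite -mulrBl mulrA; congr (_ * _).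
have /eqP := step x v Ovv; rewrite addr_eq0 => /eqP.
by move=> /(congr1 (fun r => dt * r)); rewrite mulrCA divff ?gt_eqF// mulr1; lra.
Qed.

(* [P] and [P'] are the field energy densities before and after the step; the
   hypothesis on them is Poynting's theorem in time-discrete form. *)
Lemma energy_step f f' g E B (P P' : V3 -> R) :
  admissible_density a b Ov f -> admissible_density a b Ov f' ->
  admissible_density a b Ov g ->
  admissible_field a b E -> admissible_field a b B ->
  (forall x v, Ov v -> (f' x v - f x v) / dt + transport g E B x v = 0) ->
  continuous P -> continuous P' ->
  (forall x, P' x - P x = 2 * dt *
    (dot (curl B x - current Ov g x) (E x) - dot (curl E x) (B x))) ->
  kinetic2 a b Ov f + int3 (box a b) P = kinetic2 a b Ov f' + int3 (box a b) P'.
Proof.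
move=> af af' ag aE aB step cP cP' PP'.
have [cE _ _ _] := admissible_fieldE aE; have [cB _ _ _] := admissible_fieldE aB.
have bP := bmf_box a b cP; have bP' := bmf_box a b cP'.
have bJ := bmf_dot_current oOv bOv ag cE.
have b1 := bmf_box a b (continuous_dot (continuous_curl aB) cE).
have b2 := bmf_box a b (continuous_dot (continuous_curl aE) cB).
have : int3 (box a b) P' - int3 (box a b) P =
    - (2 * dt * int3 (box a b) (fun x => dot (E x) (current Ov g x))).
  rewrite -(int3B mb bb bP' bP).
  rewrite (@eq_int3 _ _ _ (fun x => 2 * dt * ((dot (curl B x) (E x)
    - dot (curl E x) (B x)) - dot (E x) (current Ov g x)))); last first.
    by move=> x _; rewrite PP' dotBl (dotC (E x)); ring.
  rewrite (int3Z mb bb _ (bmfB (bmfB b1 b2) bJ)) (int3B mb bb (bmfB b1 b2) bJ).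
  (* Symmetry of the curl cancels the two curl terms, leaving only the work done on the current. *)
  rewrite (int3B mb bb b1 b2) (int3_curl_adjoint ab aB aE).
  rewrite (@eq_int3 _ _ _ (fun x => dot (curl E x) (B x))); last first.
    by move=> x _; rewrite dotC.
  by rewrite subrr sub0r mulrN.
have := kinetic2_step af af' ag aE aB step.
move: (kinetic2 _ _ _ f) (kinetic2 _ _ _ f') (int3 _ P) (int3 _ P') (2 * dt * _).
by move=> k k' p p' X; lra.
Qed.

End EnergyBalance.

(** * Leapfrogged fields *)

Section HalfSteps.
Variables (R : realType) (dt : R).
Hypothesis dt0 : 0 < dt.
Variables (F Fh : nat -> 'rV[R]_3 -> 'rV[R]_3) (K : nat -> 'rV[R]_3).
Variable x : 'rV[R]_3.
Hypothesis half1 : forall n, (dt / 2)^-1 *: (Fh n x - F n x) = K n.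
Hypothesis half2 : forall n, (dt / 2)^-1 *: (F n.+1 x - Fh n x) = K n.+1.

Let dt2 : dt / 2 != 0. Proof. by rewrite gt_eqF// divr_gt0. Qed.

Lemma half_nextE n : Fh n x = F n x + (dt / 2) *: K n.
Proof. by rewrite -half1 scalerA divff// scale1r addrC subrK. Qed.

(** The second half of the previous step already uses [K n], so the values at [n - 1/2] and
    [n + 1/2] are symmetric about [F n x]. The convention at [n = 0] is exactly this reflection. *)
Lemma half_prevE n : prev_half F Fh n x = F n x - (dt / 2) *: K n.
Proof.
case: n => [|m] /=.
  by rewrite half_nextE scaler_nat mulr2n opprD addrA addrK.
by rewrite -half2 scalerA divff// scale1r opprB addrC subrK.
Qed.

Lemma dot_prev_half n : dot (prev_half F Fh n x) (Fh n x) =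
  dot (F n x) (F n x) - dt ^+ 2 / 4 * dot (K n) (K n).
Proof.
rewrite half_nextE half_prevE dotDB dotZl (dotC (K n)) dotZl; congr (_ - _).
by field.
Qed.

(** This is the increment from [n - 1/2] to [n + 3/2]: two full leapfrog steps, with slopes [K n]
    and [K n.+1]. *)
Lemma half_step n : Fh n.+1 x - prev_half F Fh n x = dt *: (K n + K n.+1).
Proof.
rewrite half_prevE half_nextE; have := half_nextE n.
have : F n.+1 x = Fh n x + (dt / 2) *: K n.+1.
  by rewrite -half2 scalerA divff// scale1r addrC subrK.
move=> -> ->; apply/rowP => i; rewrite !mxE; by field.
Qed.

End HalfSteps.

(** * Conservation for the four schemes *)

Section Schemes.
Variable R : realType.
Local Notation V3 := 'rV[R]_3.
Variables (a b : V3) (Ov : set V3) (dt : R).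
Hypotheses (ab : forall i, a 0 i < b 0 i) (oOv : open Ov) (bOv : bounded_set Ov).
Hypothesis dt0 : 0 < dt.
Implicit Types (f fh : nat -> V3 -> V3 -> R) (E Eh B Bh : nat -> V3 -> V3).

Local Notation adm_dens f := (forall n, admissible_density a b Ov (f n)).
Local Notation adm_field F := (forall n, admissible_field a b (F n)).

Let incr (u w K : V3) : dt^-1 *: (w - u) = K -> w - u = dt *: K.
Proof. by move=> <-; rewrite scalerA divff ?scale1r// gt_eqF. Qed.

Let mean2 (F G : V3 -> V3) x : F x + G x = 2 *: mean_field F G x.
Proof. by rewrite /mean_field scalerA divff ?scale1r. Qed.

Let continuous_dot_field (F G : V3 -> V3) : admissible_field a b F ->
  admissible_field a b G -> continuous (fun x => dot (F x) (G x)).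
Proof.
move=> /admissible_fieldE [cF _ _ _] /admissible_fieldE [cG _ _ _].
exact: continuous_dot.
Qed.

Let continuous_energy (F G H K : V3 -> V3) : admissible_field a b F ->
  admissible_field a b G -> admissible_field a b H -> admissible_field a b K ->
  continuous (fun x => dot (F x) (G x) + dot (H x) (K x)).
Proof.
by move=> aF aG aH aK; apply: continuous_addf; exact: continuous_dot_field.
Qed.

Lemma TE_scheme2_conserved f fh E B : adm_dens f -> adm_dens fh ->
  adm_field E -> adm_field B -> scheme2 Ov dt f fh E B ->
  forall n, TE a b Ov f E B n = TE a b Ov f E B n.+1.
Proof.
move=> af afh aE aB S n; congr (_ * _); have [_ SB SE Sf] := S n.
apply: (energy_step ab oOv bOv dt0 (af n) (af n.+1) (afh n) _ _ Sf).
- exact: admissible_mean_field.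
- exact: admissible_mean_field.
- exact: continuous_energy.
- exact: continuous_energy.
(* A difference of squares is the increment times the sum; the increment comes from the scheme, and
   the sum is twice the mean field that drives the Vlasov step. *)
- move=> x; rewrite opprD addrACA !dot_sqrB (incr (SE x)) (incr (SB x)) !mean2.
  move: (mean_field (E n) _ x) (mean_field (B n) _ x) => M N.
  by rewrite !dotZl !(dotC _ (2 *: _)) !dotZl !(dotC M) !(dotC N) dotNl; ring.
Qed.

Lemma TE_scheme4_conserved f E B : adm_dens f ->
  adm_field E -> adm_field B -> scheme4 Ov dt f E B ->
  forall n, TE a b Ov f E B n = TE a b Ov f E B n.+1.
Proof.
move=> af aE aB S n; congr (_ * _); have [SB SE Sf] := S n.
have ag := admissible_mean_density (af n) (af n.+1).
apply: (energy_step ab oOv bOv dt0 (af n) (af n.+1) ag _ _ Sf).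
- exact: admissible_mean_field.
- exact: admissible_mean_field.
- exact: continuous_energy.
- exact: continuous_energy.
- move=> x; rewrite opprD addrACA !dot_sqrB (incr (SE x)) (incr (SB x)) !mean2.
  (* The mean of the two currents is the current of the mean density, which is the density
     transported in the Vlasov step. *)
  rewrite (current_mean_density _ oOv bOv (af n) (af n.+1)) -/(mean_field
    (current Ov (f n)) (current Ov (f n.+1)) x).
  move: (mean_field (E n) _ x) (mean_field (B n) _ x) => M N.
  by rewrite !dotZl !(dotC _ (2 *: _)) !dotZl !(dotC M) !(dotC N) dotNl; ring.
Qed.

(** Scheme-1 uses this with [F = B] and [K = - curl E], Scheme-3 with [F = E] and [K = curl B - J].
    The slope [K n] is only asked to be bounded and measurable, since a current is controlled
    through Fubini. *)
Lemma staggered_energy f (F Fh G K : nat -> V3 -> V3) n :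
  adm_field F -> adm_field Fh -> adm_field G ->
  (forall n x, (dt / 2)^-1 *: (Fh n x - F n x) = K n x) ->
  (forall n x, (dt / 2)^-1 *: (F n.+1 x - Fh n x) = K n.+1 x) ->
  (forall i, bmf (@vec3 R @^-1` box a b) ((fun x => K n x 0 i) \o @vec3 R)) ->
  2 * (2^-1 * (kinetic2 a b Ov (f n) + int3 (box a b)
    (fun x => dot (G n x) (G n x) + dot (prev_half F Fh n x) (Fh n x)))) =
  kinetic2 a b Ov (f n) +
  int3 (box a b) (fun x => dot (F n x) (F n x) + dot (G n x) (G n x)) -
  dt ^+ 2 / 4 * int3 (box a b) (fun x => dot (K n x) (K n x)).
Proof.
move=> aF aFh aG half1 half2 bK.
have mb := @measurable_box R a b; have bb := @bounded_box R a b.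
have bKK : bmf (@vec3 R @^-1` box a b) ((fun x => dot (K n x) (K n x)) \o @vec3 R).
  exact: (bmf_sum (fun i => bmfM (bK i) (bK i))).
have bFG := bmf_box a b (continuous_energy (aF n) (aF n) (aG n) (aG n)).
rewrite mulrA divff// mul1r -addrA; congr (_ + _).
rewrite -(int3Z mb bb _ bKK) -(int3B mb bb bFG (bmfZ _ bKK)).
apply: eq_int3 => x _.
rewrite (dot_prev_half dt0 (fun n => half1 n x) (fun n => half2 n x)).
by rewrite addrA; congr (_ - _); exact: addrC.
Qed.

Lemma TE_scheme1_conserved f fh E B Bh : adm_dens f -> adm_dens fh ->
  adm_field E -> adm_field B -> adm_field Bh -> scheme1 Ov dt f fh E B Bh ->
  forall n, TE_scheme1 a b Ov f E B Bh n = TE_scheme1 a b Ov f E B Bh n.+1 /\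
    2 * TE_scheme1 a b Ov f E B Bh n
    = kinetic2 a b Ov (f n)
      + int3 (box a b) (fun x => dot (E n x) (E n x) + dot (B n x) (B n x))
      - dt ^+ 2 / 4
        * int3 (box a b) (fun x => dot (curl (E n) x) (curl (E n) x)).
Proof.
move=> af afh aE aB aBh S n.
have half1 m x : (dt / 2)^-1 *: (Bh m x - B m x) = - curl (E m) x.
  by have [_ H _ _ _] := S m; exact: H.
have half2 m x : (dt / 2)^-1 *: (B m.+1 x - Bh m x) = - curl (E m.+1) x.
  by have [_ _ _ H _] := S m; exact: H.
have aprev m := admissible_prev_half m aB aBh.
split.
  congr (_ * _); have [_ _ SE _ Sf] := S n.
  apply: (energy_step ab oOv bOv dt0 (af n) (af n.+1) (afh n) _ _ Sf).
  - exact: admissible_mean_field.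
  - exact: aBh.
  - exact: continuous_energy.
  - exact: continuous_energy.
  - move=> x; rewrite opprD addrACA dot_sqrB (incr (SE x)) mean2.
    (* The products at [n] and [n.+1] share the factor [Bh n x], so their difference is [Bh n x]
       against the two-step increment, with slope sum minus twice the curl of the mean electric
       field. *)
    rewrite [prev_half B Bh n.+1 x]/= [dot (Bh n x) _]dotC -dotBl.
    rewrite (half_step dt0 (fun n => half1 n x) (fun n => half2 n x)).
    rewrite (curl_mean_field _ (aE n) (aE n.+1)) -opprD.
    move: (mean_field _ _ x) => M.
    by rewrite !dotZl [dot _ (2 *: _)]dotC !dotZl (dotC M) dotNl; field.
rewrite (staggered_energy f aB aBh aE half1 half2).
  congr (_ + int3 _ _ - _ * int3 _ _); apply/funext => x; first by rewrite addrC.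
  by rewrite dotNl dotC dotNl opprK.
move=> i; have := bmf_box a b (@continuous_curl _ _ _ _ (aE n) i).
move=> /(bmfZ (-1)); congr bmf; apply/funext => p.
by rewrite /= mulN1r [RHS]mxE.
Qed.

Lemma TE_scheme3_conserved f E Eh B : adm_dens f ->
  adm_field E -> adm_field Eh -> adm_field B -> scheme3 Ov dt f E Eh B ->
  forall n, TE_scheme3 a b Ov f E Eh B n = TE_scheme3 a b Ov f E Eh B n.+1 /\
    2 * TE_scheme3 a b Ov f E Eh B n
    = kinetic2 a b Ov (f n)
      + int3 (box a b) (fun x => dot (E n x) (E n x) + dot (B n x) (B n x))
      - dt ^+ 2 / 4
        * int3 (box a b)
            (fun x => dot (curl (B n) x - current Ov (f n) x)
                          (curl (B n) x - current Ov (f n) x)).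
Proof.
move=> af aE aEh aB S n.
have half1 m x : (dt / 2)^-1 *: (Eh m x - E m x) = curl (B m) x - current Ov (f m) x.
  by have [H _ _ _] := S m; exact: H.
have half2 m x : (dt / 2)^-1 *: (E m.+1 x - Eh m x) =
    curl (B m.+1) x - current Ov (f m.+1) x.
  by have [_ _ _ H] := S m; exact: H.
have aprev m := admissible_prev_half m aE aEh.
have ag := admissible_mean_density (af n) (af n.+1).
split.
  congr (_ * _); have [_ SB Sf _] := S n.
  apply: (energy_step ab oOv bOv dt0 (af n) (af n.+1) ag _ _ Sf).
  - exact: aEh.
  - exact: admissible_mean_field.
  - exact: continuous_energy.
  - exact: continuous_energy.
  - move=> x; rewrite opprD addrACA dot_sqrB (incr (SB x)) mean2.
    (* The shared factor is now [Eh n x], and the slopes add up to twice the curl of the mean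
       magnetic field minus twice the current of the mean density. *)
    rewrite [prev_half E Eh n.+1 x]/= [dot (Eh n x) _]dotC -dotBl.
    rewrite (half_step dt0 (fun n => half1 n x) (fun n => half2 n x)).
    rewrite (curl_mean_field _ (aB n) (aB n.+1)).
    rewrite (current_mean_density _ oOv bOv (af n) (af n.+1)) addrACA -opprD.
    move: (mean_field _ _ x) => M.
    by rewrite -scalerBr !dotZl [dot _ (2 *: _)]dotC !dotZl (dotC M) dotNl; field.
rewrite (staggered_energy f aE aEh aB half1 half2)//.
move=> i; apply: (eq_bmf _ (bmfB (bmf_box a b (@continuous_curl _ _ _ _ (aB n) i))
  (bmf_current oOv bOv i (af n)))) => p _.
by rewrite /= !mxE.
Qed.

End Schemes.

Unset Implicit Arguments.

Theorem theorem2p1 (R : realType) (a b : 'rV[R]_3) (Ov : set 'rV[R]_3) (dt : R)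
    (hab : forall i : 'I_3, a 0 i < b 0 i)
    (hOv : domain Ov) (hOvb : bounded_set Ov) (hdt : 0 < dt) :
  [/\ (* (i), Scheme-2 *)
      forall (f fh : nat -> 'rV[R]_3 -> 'rV[R]_3 -> R)
        (E B : nat -> 'rV[R]_3 -> 'rV[R]_3),
      (forall n, admissible_density a b Ov (f n)) ->
      (forall n, admissible_density a b Ov (fh n)) ->
      (forall n, admissible_field a b (E n)) ->
      (forall n, admissible_field a b (B n)) ->
      scheme2 Ov dt f fh E B ->
      forall n, TE a b Ov f E B n = TE a b Ov f E B n.+1,
      (* (i), Scheme-4 *)
      forall (f : nat -> 'rV[R]_3 -> 'rV[R]_3 -> R)
        (E B : nat -> 'rV[R]_3 -> 'rV[R]_3),
      (forall n, admissible_density a b Ov (f n)) ->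
      (forall n, admissible_field a b (E n)) ->
      (forall n, admissible_field a b (B n)) ->
      scheme4 Ov dt f E B ->
      forall n, TE a b Ov f E B n = TE a b Ov f E B n.+1,
      (* (ii), Scheme-1 *)
      forall (f fh : nat -> 'rV[R]_3 -> 'rV[R]_3 -> R)
        (E B Bh : nat -> 'rV[R]_3 -> 'rV[R]_3),
      (forall n, admissible_density a b Ov (f n)) ->
      (forall n, admissible_density a b Ov (fh n)) ->
      (forall n, admissible_field a b (E n)) ->
      (forall n, admissible_field a b (B n)) ->
      (forall n, admissible_field a b (Bh n)) ->
      scheme1 Ov dt f fh E B Bh ->
      forall n,
        TE_scheme1 a b Ov f E B Bh n = TE_scheme1 a b Ov f E B Bh n.+1 /\
        2 * TE_scheme1 a b Ov f E B Bh n
        = kinetic2 a b Ov (f n)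
          + int3 (box a b) (fun x => dot (E n x) (E n x) + dot (B n x) (B n x))
          - dt ^+ 2 / 4
            * int3 (box a b) (fun x => dot (curl (E n) x) (curl (E n) x)) &
      (* (iii), Scheme-3 *)
      forall (f : nat -> 'rV[R]_3 -> 'rV[R]_3 -> R)
        (E Eh B : nat -> 'rV[R]_3 -> 'rV[R]_3),
      (forall n, admissible_density a b Ov (f n)) ->
      (forall n, admissible_field a b (E n)) ->
      (forall n, admissible_field a b (Eh n)) ->
      (forall n, admissible_field a b (B n)) ->
      scheme3 Ov dt f E Eh B ->
      forall n,
        TE_scheme3 a b Ov f E Eh B n = TE_scheme3 a b Ov f E Eh B n.+1 /\
        2 * TE_scheme3 a b Ov f E Eh B n
        = kinetic2 a b Ov (f n)
          + int3 (box a b) (fun x => dot (E n x) (E n x) + dot (B n x) (B n x))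
          - dt ^+ 2 / 4
            * int3 (box a b)
                (fun x => dot (curl (B n) x - current Ov (f n) x)
                              (curl (B n) x - current Ov (f n) x))].
Proof.
have [oOv _ _] := hOv.
split.
- by move=> f fh E B af afh aE aB; exact: TE_scheme2_conserved.
- by move=> f E B af aE aB; exact: TE_scheme4_conserved.
- by move=> f fh E B Bh af afh aE aB aBh; exact: TE_scheme1_conserved.
- by move=> f E Eh B af aE aEh aB; exact: TE_scheme3_conserved.
Qed.
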